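(* Let $n\ge 1$ and let $(\mathbb{C}^n,\omega_{C,n})$ be the product of $n$ copies of the Cigar soliton, i.e. $$\omega_{C,n}=\frac{i}{2}\sum_{j=1}^n\frac{dz_j\wedge d\bar z_j}{1+|z_j|^2}.$$ Then there exists a symplectomorphism $\Psi_{C,n}:(\mathbb{C}^n,\omega_{C,n})\to(\mathbb{R}^{2n},\omega_0)$ (a diffeomorphism with $\Psi_{C,n}^*\omega_0=\omega_{C,n}$), with $\Psi_{C,n}(0)=0$, such that for every complete complex totally geodesic submanifold $S$ of $(\mathbb{C}^n,\omega_{C,n})$ through the origin, the image $\Psi_{C,n}(S)$ is a complex linear subspace of $\mathbb{C}^n\simeq\mathbb{R}^{2n}$.
   Context: The space $\mathbb{R}^{2n}$ is identified with $\mathbb{C}^n$ via $z_j=x_j+iy_j$, and $\omega_0=\sum_{j=1}^n dx_j\wedge dy_j=\frac{i}{2}\sum_{j=1}^n dz_j\wedge d\bar z_j$ is the standard symplectic form. The Cigar soliton is $\mathbb{C}$ with the Kähler form $\omega_C=\frac{i}{2}\frac{dz\wedge d\bar z}{1+|z|^2}$, whose associated Kähler (Riemannian) metric is $\frac{|dz|^2}{1+|z|^2}$. The product of $n$ copies is $\mathbb{C}^n$ with the product Kähler structure, with associated metric $\sum_{j=1}^n\frac{|dz_j|^2}{1+|z_j|^2}$. ''Totally geodesic'' and ''complete'' refer to this product metric (completeness is that of the induced metric on the submanifold). A complex submanifold is one of any complex dimension $k$, $0\le k\le n$; submanifolds are connected. *)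

(* Defs.v *)
From HB Require Import structures.
From mathcomp Require Import all_boot all_order all_algebra.
From mathcomp Require Import all_classical all_reals all_analysis.

Set Implicit Arguments.
Unset Strict Implicit.
Unset Printing Implicit Defensive.

Import Order.TTheory GRing.Theory Num.Theory.
Import numFieldNormedType.Exports.

Local Open Scope ring_scope.
Local Open Scope classical_set_scope.

(* R^(2n) = C^n with coordinates (x_1, ..., x_n, y_1, ..., y_n) and
   z_j = x_j + i y_j. *)
Notation "''Cx[' R ]_ n" := 'rV[R]_(n + n)
  (at level 8, n at level 2, format "''Cx[' R ]_ n") : type_scope.

Section ComplexSpace.
Context {R : realType} {n : nat}.
Implicit Types (z u v : 'Cx[R]_n) (j : 'I_n).

Definition re z j : R := z 0 (lshift n j).
Definition im z j : R := z 0 (rshift n j).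

(* multiplication by i *)
Definition mulI z : 'Cx[R]_n := row_mx (- rsubmx z) (lsubmx z).

Definition complex_linear_subspace (L : set 'Cx[R]_n) : Prop :=
  [/\ L 0,
      forall u v, L u -> L v -> L (u + v) &
      forall (a b : R) u, L u -> L (a *: u + b *: mulI u)].

Definition sqrmod z j : R := re z j ^+ 2 + im z j ^+ 2.

(* A 2-form, or a Riemannian metric, is a function [z u v] of a base point [z]
   and of two tangent vectors [u], [v].  Here
   dx_j /\ dy_j (u, v) = dx_j(u) dy_j(v) - dy_j(u) dx_j(v). *)
Definition standard_form (z u v : 'Cx[R]_n) : R :=
  \sum_(j < n) (re u j * im v j - im u j * re v j).

Definition cigar_form z u v : R :=
  \sum_(j < n) (re u j * im v j - im u j * re v j) / (1 + sqrmod z j).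

Definition cigar_metric z u v : R :=
  \sum_(j < n) (re u j * re v j + im u j * im v j) / (1 + sqrmod z j).

Lemma cigar_metricE z u v : cigar_metric z u v = cigar_form z u (mulI v).
Proof.
by apply: eq_bigr => j _; rewrite /re /im row_mxEl row_mxEr !mxE mulrN opprK.
Qed.

End ComplexSpace.

Section Smoothness.
Context {R : realType}.

(* Only meant for open [U]. *)
Fixpoint Cr (m : nat) (V W : normedModType R) (U : set V) (f : V -> W) : Prop :=
  if m is m'.+1 then
    (forall x, U x -> differentiable f x) /\
    (forall v, Cr m' U (fun x => 'd f x v))
  else forall x, U x -> {for x, continuous f}.

Definition smooth (V W : normedModType R) (U : set V) (f : V -> W) : Prop :=
  forall m, Cr m U f.

Definition pullback (V W : normedModType R) (f : V -> W)
    (h : W -> W -> W -> R) : V -> V -> V -> R :=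
  fun x u v => h (f x) ('d f x u) ('d f x v).

(* A smooth map whose differential commutes with multiplication by i. *)
Definition holomorphic (k n : nat) (U : set 'Cx[R]_k)
    (f : 'Cx[R]_k -> 'Cx[R]_n) : Prop :=
  smooth U f /\
  forall x u, U x -> 'd f x (mulI u) = mulI ('d f x u).

Definition symplectomorphism (n : nat)
    (om om' : 'Cx[R]_n -> 'Cx[R]_n -> 'Cx[R]_n -> R)
    (Psi : 'Cx[R]_n -> 'Cx[R]_n) : Prop :=
  [/\ smooth setT Psi,
      (exists Phi, [/\ smooth setT Phi, cancel Psi Phi & cancel Phi Psi]) &
      forall z u v, pullback Psi om' z u v = om z u v].

(* Christoffel symbol of the first kind of the metric [h]: by Koszul's formula
   for constant vector fields, it is h (nabla_u v, w) at the point [x]. *)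
Definition christoffel (V : normedModType R) (h : V -> V -> V -> R)
    (x u v w : V) : R :=
  ('D_u (fun y => h y v w) x + 'D_v (fun y => h y u w) x
   - 'D_w (fun y => h y u v) x) / 2.

(* [c] is a geodesic, on the open interval [I], of the Riemannian metric [h] on
   the open set [U]: the equation reads h (nabla_{c'} c', w) = 0 for all w. *)
Definition geodesic (V : normedModType R) (U : set V) (h : V -> V -> V -> R)
    (I : set R) (c : R -> V) : Prop :=
  [/\ smooth I c,
      forall t, I t -> U (c t) &
      forall t w, I t ->
        h (c t) (c^`()^`() t) w + christoffel h (c t) (c^`() t) (c^`() t) w = 0].

End Smoothness.

Section Submanifold.
Context {R : realType} {k n : nat}.

(* A local parametrization: a map, to be considered on an open set of C^k. *)
Record param := Param {
  pdom : set 'Cx[R]_k;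
  pmap :> 'Cx[R]_k -> 'Cx[R]_n }.

Implicit Types (S : set 'Cx[R]_n) (A : set param) (phi psi : param).

Definition overlap phi psi : set 'Cx[R]_k :=
  pdom phi `&` (phi @^-1` (psi @` pdom psi)).

(* [A] is a holomorphic atlas making [S] a complex manifold of dimension [k]
   whose inclusion in C^n is an injective holomorphic immersion.  The topology
   of [S] is the one given by [A], which may be finer than the subspace
   topology; embedded submanifolds are the case where the two agree. *)
Definition complex_submanifold S A : Prop :=
  [/\ forall phi, A phi ->
        [/\ open (pdom phi), holomorphic (pdom phi) phi,
            {in pdom phi &, injective phi},
            (forall x, pdom phi x -> injective ('d phi x)) &
            phi @` pdom phi `<=` S],
      forall p, S p -> exists2 phi, A phi & (phi @` pdom phi) p &
      forall phi psi, A phi -> A psi ->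
        open (overlap phi psi) /\
        exists2 tau : 'Cx[R]_k -> 'Cx[R]_k, holomorphic (overlap phi psi) tau &
          forall x, overlap phi psi x ->
            pdom psi (tau x) /\ psi (tau x) = phi x].

Definition submanifold_open A (V : set 'Cx[R]_n) : Prop :=
  forall phi, A phi -> open (pdom phi `&` (phi @^-1` V)).

Definition submanifold_connected S A : Prop :=
  forall V, V `<=` S ->
    submanifold_open A V -> submanifold_open A (S `\` V) ->
    V = set0 \/ V = S.

(* Geodesics of [S] for the metric induced by the ambient metric [g]. *)
Definition submanifold_geodesic A (g : 'Cx[R]_n -> 'Cx[R]_n -> 'Cx[R]_n -> R)
    (I : set R) (gam : R -> 'Cx[R]_n) : Prop :=
  forall t0, I t0 ->
    exists phi (J : set R) (c : R -> 'Cx[R]_k),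
      [/\ A phi, [/\ open J, is_interval J, J t0 & J `<=` I],
          geodesic (pdom phi) (pullback phi g) J c &
          forall t, J t -> gam t = phi (c t)].

(* The exponential map of the induced metric is defined on all tangent vectors
   ['d phi x v] of [S]. *)
Definition submanifold_complete A
    (g : 'Cx[R]_n -> 'Cx[R]_n -> 'Cx[R]_n -> R) : Prop :=
  forall phi x v, A phi -> pdom phi x ->
    exists gam : R -> 'Cx[R]_n,
      [/\ submanifold_geodesic A g setT gam,
          gam 0 = phi x & gam^`() 0 = 'd phi x v].

(* Every geodesic of the submanifold is a geodesic of the ambient space. *)
Definition totally_geodesic A
    (g : 'Cx[R]_n -> 'Cx[R]_n -> 'Cx[R]_n -> R) : Prop :=
  forall (I : set R) (gam : R -> 'Cx[R]_n), open I -> is_interval I ->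
    submanifold_geodesic A g I gam -> geodesic setT g I gam.

End Submanifold.

Arguments param : clear implicits.

(* Main.v *)
Require Import Defs.
From HB Require Import structures.
From mathcomp Require Import all_boot all_order all_algebra.
From mathcomp Require Import all_classical all_reals all_analysis.
From mathcomp Require Import ring lra.

(** On every factor, [Psi] is the radial map [z |-> sqrt (ln (1 + |z|^2)) z / |z|].

    Let [T] be the tangent space of [S] at the origin.  As [S] is complete and
    totally geodesic, its second fundamental form vanishes.  Applying the
    antiholomorphic derivatives to this identity at the origin shows that [T] is
    closed under [u, w |-> u^2 * conj w] (products taken coordinatewise), which
    is the invariance of [T] under the curvature tensor.  Lagrange interpolation
    then makes [T] invariant under [z |-> (f (|z_j|^2) z_j)_j] for every
    function [f]; in particular [Psi] maps [T] onto itself, and the acceleration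
    of the geodesic equation preserves [T].

    Finally [S = T].  The points of [S] that lie in [T] and have their tangent
    space inside [T] form a closed subset of [S], which is also open by
    Gronwall's inequality along segments in a chart; so [S] is contained in [T].
    Conversely, the geodesics of the ambient metric from the origin are
    [t |-> (sinh (t |v_j|) v_j / |v_j|)_j]; they sweep out [T] when [v] ranges
    over [T], and by completeness they stay in [S]. *)

Set Implicit Arguments.
Unset Strict Implicit.
Unset Printing Implicit Defensive.

Import Order.TTheory GRing.Theory Num.Theory.
Import numFieldNormedType.Exports.

Local Open Scope ring_scope.
Local Open Scope classical_set_scope.

(** * Calculus of smooth maps *)

(** Areas force the profile: the disc of radius [r] has cigar area pi ln (1 + r^2), so a radial
    symplectomorphism fixing 0 satisfies |Psi|^2 = ln (1 + |z|^2) on each factor. The quotient by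
    |z| hides smoothness at 0; hence the detour through [moment], a power series with
    [x * moment 0 x = expR x - 1].

    Antiholomorphic derivatives isolate the triple product because the second derivative of a chart
    is holomorphic, while the acceleration is a multiple of the conjugate of the position; at the
    origin only the derivative of that conjugate survives.

    The obstacle is that the tangent space of [S] moves with the point, so the vanishing of the
    second fundamental form is not membership in a fixed subspace. A linear map [N] with kernel [T]
    turns membership into an equation and its failure into a norm: [N] of the second fundamental
    form is bounded by [N] of the tangent vectors. Differentiated at the origin this bound yields
    the triple product; integrated along segments it keeps [S] inside [T].

    The topology of [S] may be finer than that of the ambient space, so open and closed are always
    tested in charts. *)

Section CrCalculus.
Context {R : realType}.

Lemma diff_near_eq (V W : normedModType R) (f g : V -> W) (x : V) :
  {near x, f =1 g} -> differentiable f x ->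
  differentiable g x /\ 'd g x = 'd f x :> (V -> W).
Proof.
move=> fg df.
have key : g \o shift x = cst (g x) + 'd f x +o_ 0 id.
  apply/eqaddoP => e e0; have /eqaddoP/(_ e e0) := diff_locally df.
  have c : h + x @[h --> (0 : V)] --> x.
    by rewrite -[X in _ --> X]add0r; apply: cvgD; [exact: cvg_id|exact: cvg_cst].
  move=> e2; near=> h.
  have e1 : f (h + x) = g (h + x) by near: h; exact: (c _ fg).
  have : `|(f \o shift x - (cst (f x) + 'd f x)) h| <= e * `|h| by near: h; exact: e2.
  by rewrite !fctE /= (nbhs_singleton fg) e1.
have E : 'd g x = 'd f x :> (V -> W).
  by apply: diff_unique; [exact: diff_continuous|exact: key].
split=> //; apply/diff_locallyP; rewrite E; split=> //.
exact: diff_continuous.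
Unshelve. all: by end_near. Qed.

(** Scaling is packaged as a continuous bilinear map, so the Leibniz rule is the chain rule applied
    to the pair [(k, f)]. *)
Lemma diff_scale (V W : normedModType R) (k : V -> R) (f : V -> W) (x : V) :
  differentiable k x -> differentiable f x ->
  differentiable (fun z => k z *: f z) x /\
  forall v : V, 'd (fun z => k z *: f z) x v = k x *: 'd f x v + 'd k x v *: f x.
Proof.
move=> dk df.
have s_bil : bilinear_for
    (GRing.Scale.Law.clone _ _ ( *:%R ) _) (GRing.Scale.Law.clone _ _ ( *:%R ) _)
    (fun (a : R) (w : W) => a *: w).
  by split => u a b c /=; rewrite ?scalerDl ?scalerDr ?scalerA // mulrC.
pose sM := bilinear_isBilinear.Build R R W W _ _ (fun (a : R) (w : W) => a *: w) s_bil.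
pose sB : {bilinear R -> W -> W} := HB.pack (fun (a : R) (w : W) => a *: w) sM.
have sc : continuous (fun p : R * W => sB p.1 p.2).
  by move=> p; apply: cvgZ; [exact: cvg_fst | exact: cvg_snd].
have -> : (fun z => k z *: f z) = (fun p : R * W => sB p.1 p.2) \o (fun z => (k z,
  f z)) by [].
have dp : differentiable (fun z => (k z, f z)) x by apply: differentiable_pair.
have db : differentiable (fun p : R * W => sB p.1 p.2) (k x, f x).
  exact: differentiable_bilin.
split; first exact: differentiable_comp.
by move=> v; rewrite diff_comp // diff_bilin // diff_pair.
Qed.

Implicit Types (V W : normedModType R).

Lemma diff_compE V V' W (f : V -> V') (g : V' -> W) (x u : V) :
  differentiable f x -> differentiable g (f x) ->
  'd (fun y => g (f y)) x u = 'd g (f x) ('d f x u).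
Proof. by move=> df dg; rewrite [LHS](congr1 (@^~ u) (diff_comp df dg)). Qed.

Lemma diff_addE V W (f g : V -> W) (x u : V) :
  differentiable f x -> differentiable g x ->
  'd (fun y => f y + g y) x u = 'd f x u + 'd g x u.
Proof. by move=> df dg; rewrite [LHS](congr1 (@^~ u) (diffD df dg)). Qed.


Lemma Cr_ext m V W (U : set V) (f g : V -> W) : open U ->
  (forall x, U x -> f x = g x) -> Cr m U f -> Cr m U g.
Proof.
move=> oU; elim: m f g => [|m IH] f g fg /=.
  move=> cf x Ux.
  have nfg : {near x, f =1 g}.
    by move: (open_nbhs_nbhs (conj oU Ux)); apply: filterS => y; exact: fg.
  rewrite /prop_for /continuous_at -(fg x Ux).
  by apply: cvg_trans (cf x Ux); exact: near_eq_cvg.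
move=> [df Cf].
have key x : U x -> differentiable g x /\ 'd g x = 'd f x :> (V -> W).
  move=> Ux; apply: diff_near_eq (df x Ux).
  by move: (open_nbhs_nbhs (conj oU Ux)); apply: filterS => y; exact: fg.
split=> [x /key[]//|v].
by apply: IH (Cf v) => x Ux; rewrite (key x Ux).2.
Qed.

Lemma CrW m V W (U : set V) (f : V -> W) : Cr m.+1 U f -> Cr m U f.
Proof.
elim: m f => [|m IH] f.
  by move=> [df _] x Ux; exact: differentiable_continuous (df x Ux).
by move=> [df Cf]; split=> // v; apply: IH.
Qed.

Lemma Cr_sub m V W (U U' : set V) (f : V -> W) :
  U' `<=` U -> Cr m U f -> Cr m U' f.
Proof.
move=> sU; elim: m f => [|m IH] f /=; first by move=> cf x /sU /cf.
by move=> [df Cf]; split=> [x /sU /df//|v]; exact: IH.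
Qed.

Lemma Cr_cst m V W (U : set V) (a : W) : Cr m U (fun _ : V => a).
Proof.
elim: m a => [|m IH] a /=; first by move=> x _; exact: cvg_cst.
split=> [x _|v]; first exact: differentiable_cst.
by rewrite (_ : (fun _ => _) = fun=> 0) // funeqE => x; rewrite (diff_cst a).
Qed.

Lemma Cr_linear m V W (U : set V) (f : {linear V -> W}) :
  continuous f -> Cr m U f.
Proof.
move=> cf; case: m => [x _|m] /=; first exact: cf.
split=> [x _|v]; first exact: linear_differentiable.
rewrite (_ : (fun _ => _) = fun=> f v); first exact: Cr_cst.
by rewrite funeqE => x; rewrite diff_lin.
Qed.


Lemma Cr_lin_comp m V W W' (U : set V) (f : V -> W) (l : {linear W -> W'}) :
  open U -> continuous l -> Cr m U f -> Cr m U (fun x => l (f x)).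
Proof.
move=> oU cl; elim: m f => [|m IH] f /=.
  by move=> cf x Ux; apply: (continuous_comp (cf x Ux)); exact: cl.
move=> [df Cf].
have dl y : differentiable l y by exact: linear_differentiable.
split=> [x Ux|v]; first by apply: differentiable_comp => //; exact: df.
apply: Cr_ext (IH _ (Cf v)) => // x Ux.
by rewrite (diff_comp (df x Ux) (dl _)) /= diff_lin.
Qed.

Lemma Cr_add m V W (U : set V) (f g : V -> W) :
  open U -> Cr m U f -> Cr m U g -> Cr m U (fun x => f x + g x).
Proof.
move=> oU; elim: m f g => [|m IH] f g /=.
  by move=> cf cg x Ux; apply: cvgD; [exact: cf|exact: cg].
move=> [df Cf] [dg Cg].
split=> [x Ux|v]; first by apply: differentiableD; [exact: df|exact: dg].
apply: Cr_ext (IH _ _ (Cf v) (Cg v)) => // x Ux.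
exact: esym (diff_addE v (df x Ux) (dg x Ux)).
Qed.

Lemma Cr_sum m V W (U : set V) (I : Type) (r : seq I) (P : pred I) (f : I -> V -> W) :
  open U -> (forall i, Cr m U (f i)) -> Cr m U (fun x => \sum_(i <- r | P i) f i x).
Proof.
move=> oU Cf; elim: r => [|i r IH].
  by apply: (Cr_ext oU) (Cr_cst m U 0) => x _; rewrite big_nil.
case Pi : (P i); last by apply: Cr_ext IH => // x _; rewrite big_cons Pi.
by apply: (Cr_ext oU) (Cr_add oU (Cf i) IH) => x _; rewrite big_cons Pi.
Qed.

Lemma Cr_scale m V W (U : set V) (k : V -> R) (f : V -> W) :
  open U -> Cr m U k -> Cr m U f -> Cr m U (fun x => k x *: f x).
Proof.
move=> oU; elim: m k f => [|m IH] k f /=.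
  by move=> cf cg x Ux; apply: cvgZ; [exact: cf|exact: cg].
move=> [dk Ck] [df Cf].
split=> [x Ux|v]; first by have [] := diff_scale (dk x Ux) (df x Ux).
have Ck' : Cr m U k by apply: CrW.
have Cf' : Cr m U f by apply: CrW.
apply: Cr_ext (Cr_add oU (IH _ _ Ck' (Cf v)) (IH _ _ (Ck v) Cf')) => // x Ux.
exact: esym ((diff_scale (dk x Ux) (df x Ux)).2 v).
Qed.

Lemma Cr_mul m V (U : set V) (f g : V -> R) :
  open U -> Cr m U f -> Cr m U g -> Cr m U (fun x => f x * g x).
Proof. exact: Cr_scale. Qed.

(** [Cr] controls ['d g y v] only for a fixed [v], whereas the chain rule produces the moving vector
    ['d f x v]. Expanding it in a basis [e] with coordinates [l] leaves sums of products of
    functions of class [m], to which the induction applies. *)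
Lemma Cr_comp_split m V V' W (I : finType) (e : I -> V') (l : I -> {linear V' -> R})
    (U : set V) (U' : set V') (f : V -> V') (g : V' -> W) :
  (forall i, continuous (l i)) -> (forall w, w = \sum_i l i w *: e i) ->
  open U -> (forall x, U x -> U' (f x)) ->
  Cr m U f -> Cr m U' g -> Cr m U (fun x => g (f x)).
Proof.
move=> cl el oU UU'; elim: m f g UU' => [|m IH] f g UU' /=.
  by move=> cf cg x Ux; apply: (continuous_comp (cf x Ux)); apply/cg/UU'.
move=> [df Cf] [dg Cg].
split=> [x Ux|v].
  by apply: (differentiable_comp (df x Ux)); apply/dg/UU'.
have Cf' : Cr m U f by apply: CrW.
apply: (@Cr_ext _ _ _ _ (fun x => \sum_i l i ('d f x v) *: 'd g (f x) (e i))) => //.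
  move=> x Ux; rewrite (diff_comp (df x Ux) (dg _ (UU' _ Ux))) /=.
  rewrite [in RHS](el ('d f x v)) linear_sum; apply: eq_bigr => i _.
  by rewrite linearZ.
apply: Cr_sum => // i; apply: Cr_scale => //; last exact: (IH f (fun y => 'd g y (e
  i)) UU').
exact: Cr_lin_comp.
Qed.

Lemma Cr_comp1 m V W (U : set V) (U' : set R) (f : V -> R) (g : R -> W) :
  open U -> (forall x, U x -> U' (f x)) ->
  Cr m U f -> Cr m U' g -> Cr m U (fun x => g (f x)).
Proof.
move=> oU UU' Cf Cg.
apply: (@Cr_comp_split m V R W unit (fun=> 1) (fun=> idfun) U U' f g) => //.
  by move=> _ x; exact: cvg_id.
by move=> w; rewrite big_const card_unit /= addr0 [_ *: _]mulr1.
Qed.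

Definition rowc n (j : 'I_n) (w : 'rV[R]_n) : R := w 0 j.

Lemma rowc_is_linear n (j : 'I_n) : linear (@rowc n j).
Proof. by move=> a u v; rewrite /rowc !mxE. Qed.

HB.instance Definition _ n (j : 'I_n) :=
  GRing.isLinear.Build _ _ _ _ (@rowc n j) (rowc_is_linear j).

Lemma rowc_continuous n (j : 'I_n) : continuous (@rowc n j).
Proof. by move=> x; exact: coord_continuous. Qed.

Lemma Cr_comp m V W n (U : set V) (U' : set 'rV[R]_n)
    (f : V -> 'rV[R]_n) (g : 'rV[R]_n -> W) :
  open U -> (forall x, U x -> U' (f x)) ->
  Cr m U f -> Cr m U' g -> Cr m U (fun x => g (f x)).
Proof.
move=> oU UU' Cf Cg.
apply: (@Cr_comp_split m V 'rV[R]_n W 'I_n (fun j => delta_mx 0 j) (@rowc n) U U' f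
  g) => //.
  by move=> j; exact: rowc_continuous.
by move=> w; rewrite [LHS]row_sum_delta.
Qed.

Lemma Cr_row m V n (U : set V) (f : V -> 'rV[R]_n) :
  open U -> (forall j, Cr m U (fun x => f x 0 j)) -> Cr m U f.
Proof.
move=> oU Cf.
apply: (@Cr_ext _ _ _ _ (fun x => \sum_j f x 0 j *: delta_mx 0 j)) => //.
  by move=> x _; rewrite -row_sum_delta.
by apply: Cr_sum => // j; apply: Cr_scale => //; exact: Cr_cst.
Qed.

Lemma Cr_coord m V n (U : set V) (f : V -> 'rV[R]_n) j :
  open U -> Cr m U f -> Cr m U (fun x => f x 0 j).
Proof. by move=> oU; apply: (Cr_lin_comp oU (@rowc_continuous n j)). Qed.

(** A sequence in which each function is the derivative of the previous one is smooth:
    differentiating only shifts the index. *)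
Lemma Cr_family m (U : set R) (h : nat -> R -> R) :
  (forall i x, U x -> is_derive x 1 (h i) (h i.+1 x)) -> open U ->
  forall i, Cr m U (h i).
Proof.
move=> hd oU; elim: m => [|m IH] i /=.
  move=> x Ux; have /derivable1_diffP : derivable (h i) x 1 by have [] := hd i x Ux.
  exact: differentiable_continuous.
have dh x : U x -> differentiable (h i) x.
  by move=> Ux; apply/derivable1_diffP; have [] := hd i x Ux.
split=> // v; apply: (@Cr_ext _ _ _ _ (fun x => v * h i.+1 x)) => //.
  move=> x Ux; rewrite diff1E ?derive1E; last exact: dh.
  by have [_ ->] := hd i x Ux.
by apply: Cr_mul => //; exact: Cr_cst.
Qed.

End CrCalculus.

(** * The radial profile *)

Section OneVariable.
Context {R : realType}.
Implicit Types (x u s : R) (m : nat).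

(** The coefficient is the integral of t^(m+k) / k! over [0, 1]. *)
Definition moment_coeff m : R ^nat := fun k => ((k`! * (k + m.+1))%:R)^-1.

(* [moment m x] is the integral of [t ^ m * expR (t * x)] over [0, 1]. *)
Definition moment m x : R := limn (pseries (moment_coeff m) x).

Lemma is_cvg_moment m x : cvgn (pseries (moment_coeff m) x).
Proof.
apply: normed_cvg; rewrite /normed_series_of /=.
apply: (@series_le_cvg _ _ (exp_coeff `|x|)).
- by move=> k; exact: normr_ge0.
- by move=> k; rewrite /exp_coeff /= divr_ge0 // exprn_ge0.
- move=> k; rewrite /exp_coeff /moment_coeff /= normrM normrX mulrC.
  rewrite ler_wpM2l ?exprn_ge0 // ger0_norm ?invr_ge0 // lef_pV2 ?posrE ?ltr0n
    ?muln_gt0 ?fact_gt0 ?addnS //.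
  by rewrite ler_nat leq_pmulr.
- exact: is_cvg_series_exp_coeff.
Qed.

Lemma moment_coeff_diffs m : pseries_diffs (moment_coeff m) = moment_coeff m.+1.
Proof.
apply/funext => k; rewrite /pseries_diffs /moment_coeff factS.
by rewrite addSnnS -mulnA natrM invfM mulrA divff ?mul1r.
Qed.

Lemma is_derive_moment m x : is_derive x 1 (moment m) (moment m.+1 x).
Proof.
rewrite /moment -(moment_coeff_diffs m).
(* All the series converge everywhere, so any point of modulus greater than [|x|] can serve as
   radius. *)
apply: (@pseries_snd_diffs _ _ (`|x| + 1)); rewrite ?moment_coeff_diffs;
  try exact: is_cvg_moment.
by rewrite [ltRHS]ger0_norm ?addr_ge0 // ltrDl.
Qed.

(** The product form absorbs the removable singularity of (e^x - 1) / x at 0; it comes from shifting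
    the exponential series by one term. *)
Lemma moment0E x : x * moment 0 x = expR x - 1.
Proof.
have h1 : x * series (fun k => moment_coeff 0 k * x ^+ k) n + 1 @[n --> \oo]
    --> x * moment 0 x + 1.
  by apply: cvgD; [apply: cvgM; [exact: cvg_cst|exact: is_cvg_moment] | exact: cvg_cst].
have h2 : series (exp_coeff x) n.+1 @[n --> \oo] --> expR x.
  by rewrite (cvg_shiftS (series (exp_coeff x))); exact: is_cvg_series_exp_coeff.
have E : (fun n => series (exp_coeff x) n.+1) =
    (fun n => x * series (fun k => moment_coeff 0 k * x ^+ k) n + 1).
  apply/funext => n; rewrite /series /= big_nat_recl //= {1}/exp_coeff /= expr0
    fact0 divr1 addrC.
  congr (_ + _); rewrite mulr_sumr; apply: eq_big_nat => k _.
  rewrite /moment_coeff /exp_coeff /= exprS addn1 factS mulnC.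
  by rewrite mulrCA mulrC.
rewrite E in h2.
have := cvg_unique _ h1 h2 => /(_ (@Rhausdorff R)) <-.
by rewrite addrK.
Qed.

Lemma moment0_gt0 x : 0 < moment 0 x.
Proof.
have := moment0E x; have [->|x0] := eqVneq x 0; last first.
  move=> /(canRL (mulKf x0)) ->; move: x0; rewrite neq_lt => /orP[x0|x0].
    by rewrite nmulr_rgt0 ?invr_lt0 // subr_lt0 expR_lt1.
  by rewrite mulr_gt0 ?invr_gt0 // subr_gt0 expR_gt1.
move=> _.
(* At 0 the identity [moment0E] carries no information; its derivative there gives
   [moment 0 0 = 1]. *)
have : is_derive (0 : R) 1 (fun x => x * moment 0 x) (0 * moment 1 0 + moment 0 0 * 1).
  rewrite -[0 * _]/(id (0 : R) *: _).
  exact: (@is_deriveM _ _ id (moment 0) 0 1 1 (moment 1 0) (is_derive_id _ _)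
    (is_derive_moment _ _)).
rewrite (_ : (fun x => x * moment 0 x) = expR - cst 1); last first.
  by apply/funext => y; rewrite moment0E.
move=> [_]; have [_ ->] : is_derive (0 : R) 1 (expR - cst 1) (expR 0 - 0) by exact:
  is_deriveB.
by rewrite expR0 subr0 mul0r add0r mulr1 => <-.
Qed.

Lemma Cr_moment r m : Cr r [set: R] (moment m).
Proof. by apply: Cr_family openT m => i x _; exact: is_derive_moment. Qed.

Lemma Cr_expR r : Cr r [set: R] (@expR R).
Proof.
have dE (i : nat) (x : R) : setT x -> is_derive x 1 (@expR R) (expR x) by move=> _;
  exact: is_derive_expR.
exact: (@Cr_family R r setT (fun=> @expR R) dE openT 0%N).
Qed.

Lemma open_neq0 : open [set x : R | x != 0].
Proof. exact: open_neq. Qed.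

Lemma Cr_inv r : Cr r [set x : R | x != 0] (@GRing.inv R).
Proof.
elim: r => [|r IH] /=; first by move=> x x0; exact: inv_continuous.
split=> [x|v]; first exact: differentiable_Rinv.
apply: (@Cr_ext _ _ _ _ _ (fun x => - v * (x^-1 * x^-1))).
- exact: open_neq0.
- by move=> x x0; rewrite diff_Rinv // /GRing.scale /= expr2 invfM mulNr mulNr mulrC.
- by apply: Cr_mul; [exact: open_neq0|exact: Cr_cst|apply: Cr_mul => //;
  exact: open_neq0].
Qed.

Lemma open_pos : open [set x : R | 0 < x].
Proof. exact: open_gt. Qed.

Lemma Cr_ln r : Cr r [set x : R | 0 < x] (@ln R).
Proof.
case: r => [|r] /=; first by move=> x x0; exact: continuous_ln.
have dl x : 0 < x -> differentiable (@ln R) x.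
  by move=> x0; apply/derivable1_diffP; have [] := is_derive1_ln x0.
split=> [x|v]; first exact: dl.
apply: (@Cr_ext _ _ _ _ _ (fun x => v * x^-1)).
- exact: open_pos.
- move=> x x0; rewrite diff1E ?derive1E; last exact: dl.
  by have [_ ->] := is_derive1_ln x0.
- apply: Cr_mul; [exact: open_pos|exact: Cr_cst|].
  by apply: Cr_sub (Cr_inv r) => x /=; exact: lt0r_neq0.
Qed.

(** This is the square root of (e^u - 1) / u, written with [expR] and [ln] so that smoothness
    follows from positivity of [moment 0], also at [u = 0]. *)
Definition dilation u : R := expR (ln (moment 0 u) / 2).
(** This is the square root of ln (1 + s) / s: with u = ln (1 + s), [moment 0 u] equals s / u away
    from 0. *)
Definition contraction s : R := expR (- (ln (moment 0 (ln (1 + s))) / 2)).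

Lemma Cr_dilation r : Cr r [set: R] dilation.
Proof.
apply: (Cr_comp1 (U' := setT) (g := @expR R)) (Cr_expR r) => //; first exact: openT.
apply: Cr_mul; [exact: openT| |exact: Cr_cst].
apply: (Cr_comp1 (U' := [set x | 0 < x]) (g := @ln R)) (Cr_ln r); first exact: openT.
  by move=> x _; exact: moment0_gt0.
exact: Cr_moment.
Qed.

Lemma open_gtN1 : open [set x : R | -1 < x].
Proof. exact: open_gt. Qed.

Lemma Cr_contraction r : Cr r [set s : R | -1 < s] contraction.
Proof.
have o1 := open_gtN1.
apply: (Cr_comp1 (U' := setT) (g := @expR R)) (Cr_expR r) => //.
apply: (@Cr_ext _ _ _ _ _ (fun s => - 2^-1 * ln (moment 0 (ln (1 + s))))).
- exact: o1.
- by move=> s _; rewrite mulNr mulrC.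
apply: Cr_mul; [exact: o1|exact: Cr_cst|].
apply: (Cr_comp1 (U' := [set x | 0 < x]) (g := @ln R)) (Cr_ln r); first exact: o1.
  by move=> x _; exact: moment0_gt0.
apply: (Cr_comp1 (U' := setT) (g := moment 0)) (Cr_moment r 0) => //.
apply: (Cr_comp1 (U' := [set x | 0 < x]) (g := @ln R)) (Cr_ln r); first exact: o1.
  by move=> x /= x1; rewrite -ltrBlDl sub0r.
apply: Cr_add; [exact: o1|exact: Cr_cst|].
by apply: (@Cr_linear _ _ _ _ _ idfun) => x; exact: cvg_id.
Qed.

Lemma dilation_sqr u : u * dilation u ^+ 2 = expR u - 1.
Proof.
rewrite -moment0E; congr (_ * _).
by rewrite /dilation -expRM_natr divfK ?pnatr_eq0 // lnK // posrE moment0_gt0.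
Qed.

Lemma contraction_dilation s : contraction s * dilation (ln (1 + s)) = 1.
Proof. by rewrite /contraction /dilation expRN mulVf // gt_eqF // expR_gt0. Qed.

Lemma contraction_sqr s : -1 < s -> s * contraction s ^+ 2 = ln (1 + s).
Proof.
move=> s1; have s0 : 0 < 1 + s by rewrite -ltrBlDl sub0r.
have := dilation_sqr (ln (1 + s)); rewrite lnK ?posrE // addrAC subrr add0r => {1}<-.
by rewrite -mulrA -exprMn mulrC [_ * contraction s]mulrC contraction_dilation
  expr1n mul1r.
Qed.

(** Differentiate [contraction_sqr]. The left side is the Jacobian determinant of the planar map z
    -> c(|z|^2) z, and the right side is the density of the cigar form. *)
Lemma contraction_derive s : -1 < s ->
  contraction s ^+ 2 + 2 * s * contraction s * 'D_1 contraction s = (1 + s)^-1.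
Proof.
move=> s1; have s0 : 0 < 1 + s by rewrite -ltrBlDl sub0r.
have dc : is_derive s 1 contraction ('D_1 contraction s).
  apply: derivableP; apply/derivable1_diffP.
  by have [/(_ s s1)] := Cr_contraction 1.
have d1 : is_derive s 1 (id * contraction ^+ 2)
    (s *: ((2%:R * contraction s ^+ 1) *: 'D_1 contraction s) + (contraction ^+ 2)
      s *: 1).
  exact: is_deriveM.
have d2 : is_derive s 1 (@ln R \o (cst 1 + id)) ((1 + s)^-1 * (0 + 1)).
  by apply: is_derive1_comp; exact: is_derive1_ln.
have : {near s, (id * contraction ^+ 2 : R -> R) =1 @ln R \o (cst 1 + id)}.
  move: (open_nbhs_nbhs (conj open_gtN1 s1)); apply: filterS => t t1.
  by rewrite /= -contraction_sqr.
move=> /(@near_eq_derive R R R _ _ s 1) E.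
have [_ e1] := d1; have [_ e2] := d2; move: E; rewrite e1 e2 add0r mulr1 => <-.
rewrite /GRing.scale /= mulr1 expr1 addrC; congr (_ + _); ring.
Qed.

End OneVariable.

(** * The symplectomorphism *)

Section ComplexVectors.
Context {R : realType} {n : nat}.
Implicit Types (z u v w p q r : 'Cx[R]_n) (d : 'I_n -> R) (j : 'I_n).

Definition cscale d z : 'Cx[R]_n :=
  row_mx (\row_j (d j * re z j)) (\row_j (d j * im z j)).
Definition cmul u v : 'Cx[R]_n :=
  row_mx (\row_j (re u j * re v j - im u j * im v j))
         (\row_j (re u j * im v j + im u j * re v j)).
Definition cconj z : 'Cx[R]_n := row_mx (lsubmx z) (- rsubmx z).

Lemma reD u v j : re (u + v) j = re u j + re v j. Proof. by rewrite /re mxE. Qed.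
Lemma imD u v j : im (u + v) j = im u j + im v j. Proof. by rewrite /im mxE. Qed.
Lemma reN u j : re (- u) j = - re u j. Proof. by rewrite /re mxE. Qed.
Lemma imN u j : im (- u) j = - im u j. Proof. by rewrite /im mxE. Qed.
Lemma reZ a u j : re (a *: u) j = a * re u j. Proof. by rewrite /re mxE. Qed.
Lemma imZ a u j : im (a *: u) j = a * im u j. Proof. by rewrite /im mxE. Qed.
Lemma re0 j : re (0 : 'Cx[R]_n) j = 0. Proof. by rewrite /re mxE. Qed.
Lemma im0 j : im (0 : 'Cx[R]_n) j = 0. Proof. by rewrite /im mxE. Qed.
Lemma re_mulI u j : re (mulI u) j = - im u j.
Proof. by rewrite /re /mulI row_mxEl !mxE. Qed.
Lemma im_mulI u j : im (mulI u) j = re u j.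
Proof. by rewrite /im /mulI row_mxEr !mxE. Qed.
Lemma re_cscale d u j : re (cscale d u) j = d j * re u j.
Proof. by rewrite /re row_mxEl !mxE. Qed.
Lemma im_cscale d u j : im (cscale d u) j = d j * im u j.
Proof. by rewrite /im row_mxEr !mxE. Qed.
Lemma re_cmul u v j : re (cmul u v) j = re u j * re v j - im u j * im v j.
Proof. by rewrite /re row_mxEl !mxE. Qed.
Lemma im_cmul u v j : im (cmul u v) j = re u j * im v j + im u j * re v j.
Proof. by rewrite /im row_mxEr !mxE. Qed.
Lemma re_cconj u j : re (cconj u) j = re u j.
Proof. by rewrite /re row_mxEl !mxE. Qed.
Lemma im_cconj u j : im (cconj u) j = - im u j.
Proof. by rewrite /im row_mxEr !mxE. Qed.

Definition cxE := (reD, imD, reN, imN, reZ, imZ, re0, im0, re_mulI, im_mulI,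
  re_cscale, im_cscale, re_cmul, im_cmul, re_cconj, im_cconj).

Lemma cx_ext u v : (forall j, re u j = re v j /\ im u j = im v j) -> u = v.
Proof.
move=> h; apply/rowP => i; rewrite -(splitK i); case: (fintype.split i) => j /=.
  exact: (h j).1.
exact: (h j).2.
Qed.

Lemma sqrmod_ge0 z j : 0 <= sqrmod z j.
Proof. by rewrite addr_ge0 ?sqr_ge0. Qed.

Lemma sqrmod_cscale d z j : sqrmod (cscale d z) j = d j ^+ 2 * sqrmod z j.
Proof. by rewrite /sqrmod !cxE; ring. Qed.

Lemma cscaleA d d' z : cscale d (cscale d' z) = cscale (fun j => d j * d' j) z.
Proof. by apply: cx_ext => j; rewrite !cxE !mulrA. Qed.

Lemma eq_cscale d d' z : (forall j, d j = d' j) -> cscale d z = cscale d' z.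
Proof. by move=> e; apply: cx_ext => j; rewrite !cxE e. Qed.

Lemma cscale1 z : cscale (fun=> 1) z = z.
Proof. by apply: cx_ext => j; rewrite !cxE !mul1r. Qed.

Lemma mulI_is_linear : linear (@mulI R n).
Proof. by move=> a u v; apply: cx_ext => j; rewrite !cxE; split; ring. Qed.

Section Calculus.
Context {V : normedModType R}.
Implicit Types (f : V -> 'Cx[R]_n) (U : set V).

Lemma Cr_re m U f j : open U -> Cr m U f -> Cr m U (fun x => re (f x) j).
Proof. exact: Cr_coord. Qed.

Lemma Cr_im m U f j : open U -> Cr m U f -> Cr m U (fun x => im (f x) j).
Proof. exact: Cr_coord. Qed.

Lemma Cr_cx m U f : open U -> (forall j, Cr m U (fun x => re (f x) j)) ->
  (forall j, Cr m U (fun x => im (f x) j)) -> Cr m U f.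
Proof.
move=> oU hr hi; apply: Cr_row => // i.
by rewrite -(splitK i); case: (fintype.split i) => j /=; [exact: hr|exact: hi].
Qed.

Lemma Cr_sqrmod m U f j : open U -> Cr m U f -> Cr m U (fun x => sqrmod (f x) j).
Proof.
move=> oU Cf; apply: Cr_add => //; under eq_fun do rewrite expr2.
  by apply: Cr_mul => //; exact: Cr_re.
by apply: Cr_mul => //; exact: Cr_im.
Qed.

Lemma diff_coord m (g : V -> 'rV[R]_m) x i : differentiable g x ->
  differentiable (fun y => g y 0 i) x /\
  forall u : V, 'd (fun y => g y 0 i) x u = 'd g x u 0 i.
Proof.
move=> df; have dl y : differentiable (@rowc R m i) y.
  by apply: linear_differentiable; exact: rowc_continuous.
split; first exact: (differentiable_comp df (dl _)).
move=> u; rewrite (diff_comp df (dl _)) /= diff_lin //.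
exact: rowc_continuous.
Qed.

Lemma diff_re f x j (u : V) : differentiable f x ->
  'd (fun y => re (f y) j) x u = re ('d f x u) j.
Proof. by move=> /diff_coord => /(_ (lshift n j))[]. Qed.

Lemma diff_im f x j (u : V) : differentiable f x ->
  'd (fun y => im (f y) j) x u = im ('d f x u) j.
Proof. by move=> /diff_coord => /(_ (rshift n j))[]. Qed.

End Calculus.

Lemma Cr_id m (U : set 'Cx[R]_n) : Cr m U id.
Proof. by apply: (@Cr_linear _ _ _ _ _ idfun) => x; exact: cvg_id. Qed.

Lemma diff_sqrmod z u j : differentiable (fun z => sqrmod z j) z /\
  'd (fun z => sqrmod z j) z u = 2 * (re z j * re u j + im z j * im u j).
Proof.
have dl i : differentiable (fun z : 'Cx[R]_n => z 0 i) z /\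
    forall u, 'd (fun z : 'Cx[R]_n => z 0 i) z u = u 0 i.
  have did : differentiable (id : 'Cx[R]_n -> 'Cx[R]_n) z by apply: ex_diff.
  have [? e] := @diff_coord _ _ id z i did.
  by split=> // v; rewrite e diff_val.
have [dr er] := dl (lshift n j); have [di ei] := dl (rshift n j).
have [dr2 er2] := diff_scale dr dr; have [di2 ei2] := diff_scale di di.
have -> : (fun z : 'Cx[R]_n => sqrmod z j) =
   (fun z : 'Cx[R]_n => z 0 (lshift n j) *: z 0 (lshift n j) + z 0 (rshift n j) *:
     z 0 (rshift n j)).
  by apply/funext => w; rewrite /sqrmod !expr2.
split; first exact: differentiableD.
by rewrite (diff_addE _ dr2 di2) er2 ei2 er ei /re /im /GRing.scale /=; ring.
Qed.

Definition Psi z : 'Cx[R]_n := cscale (fun j => contraction (sqrmod z j)) z.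
Definition Phi z : 'Cx[R]_n := cscale (fun j => dilation (sqrmod z j)) z.

Lemma contraction_sqrmod_Cr m j :
  Cr m [set: 'Cx[R]_n] (fun z => contraction (sqrmod z j)).
Proof.
apply: (Cr_comp1 (U' := [set s : R | -1 < s]) (g := contraction)) (Cr_contraction m).
- exact: openT.
- by move=> x _ /=; rewrite (lt_le_trans _ (sqrmod_ge0 x j)) // ltrN10.
- by apply: Cr_sqrmod; [exact: openT|exact: Cr_id].
Qed.

Lemma smooth_Psi : smooth setT Psi.
Proof.
move=> m; apply: Cr_cx; first exact: openT.
  move=> j; under eq_fun do rewrite re_cscale.
  by apply: Cr_mul; [exact: openT|exact: contraction_sqrmod_Cr|apply: Cr_re;
    [exact: openT|exact: Cr_id]].
move=> j; under eq_fun do rewrite im_cscale.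
by apply: Cr_mul; [exact: openT|exact: contraction_sqrmod_Cr|apply: Cr_im;
  [exact: openT|exact: Cr_id]].
Qed.

Lemma smooth_Phi : smooth setT Phi.
Proof.
have Cd m j : Cr m [set: 'Cx[R]_n] (fun z => dilation (sqrmod z j)).
  apply: (Cr_comp1 (U' := setT) (g := dilation)) (Cr_dilation m) => //;
    first exact: openT.
  by apply: Cr_sqrmod; [exact: openT|exact: Cr_id].
move=> m; apply: Cr_cx; first exact: openT.
  move=> j; under eq_fun do rewrite re_cscale.
  by apply: Cr_mul; [exact: openT|exact: Cd|apply: Cr_re; [exact: openT|exact: Cr_id]].
move=> j; under eq_fun do rewrite im_cscale.
by apply: Cr_mul; [exact: openT|exact: Cd|apply: Cr_im; [exact: openT|exact: Cr_id]].
Qed.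

Lemma sqrmod_gtN1 z j : -1 < sqrmod z j.
Proof. by rewrite (lt_le_trans _ (sqrmod_ge0 z j)) // ltrN10. Qed.

Lemma sqrmod_Psi z j : sqrmod (Psi z) j = ln (1 + sqrmod z j).
Proof. by rewrite sqrmod_cscale mulrC contraction_sqr // sqrmod_gtN1. Qed.

Lemma sqrmod_Phi z j : sqrmod (Phi z) j = expR (sqrmod z j) - 1.
Proof. by rewrite sqrmod_cscale mulrC dilation_sqr. Qed.

Lemma PsiK : cancel Psi Phi.
Proof.
move=> z; rewrite /Phi {2}/Psi cscaleA -[RHS]cscale1; apply: eq_cscale => j.
by rewrite sqrmod_Psi mulrC contraction_dilation.
Qed.

Lemma PhiK : cancel Phi Psi.
Proof.
move=> z; rewrite /Psi {2}/Phi cscaleA -[RHS]cscale1; apply: eq_cscale => j.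
have e : ln (1 + sqrmod (Phi z) j) = sqrmod z j.
  by rewrite sqrmod_Phi addrC subrK expRK.
by rewrite -[in dilation _]e contraction_dilation.
Qed.

Lemma Psi0 : Psi 0 = 0.
Proof. by apply: cx_ext => j; rewrite !cxE !mulr0. Qed.

Lemma diff_Psi z u j (D := 2 * (re z j * re u j + im z j * im u j) * 'D_1
  contraction (sqrmod z j)) :
  re ('d Psi z u) j = contraction (sqrmod z j) * re u j + D * re z j /\
  im ('d Psi z u) j = contraction (sqrmod z j) * im u j + D * im z j.
Proof.
have dP : differentiable Psi z by have [/(_ z I)] := smooth_Psi 1.
have [ds es] := diff_sqrmod z u j.
have dc : differentiable (contraction : R -> R) (sqrmod z j).
  by have [/(_ _ (sqrmod_gtN1 z j))] := @Cr_contraction R 1.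
have dk : differentiable (fun z => contraction (sqrmod z j)) z.
  exact: (differentiable_comp ds dc).
have ek : 'd (fun z => contraction (sqrmod z j)) z u = D.
  by rewrite (diff_compE u ds dc) es (diff1E dc) derive1E.
have dl i : differentiable (fun z : 'Cx[R]_n => z 0 i) z /\
    forall u, 'd (fun z : 'Cx[R]_n => z 0 i) z u = u 0 i.
  have did : differentiable (id : 'Cx[R]_n -> 'Cx[R]_n) z by apply: ex_diff.
  have [? e] := @diff_coord _ _ id z i did.
  by split=> // v; rewrite e diff_val.
rewrite -diff_re // -diff_im //; split.
  have [dr er] := dl (lshift n j).
  rewrite (_ : (fun y => re (Psi y) j) = (fun z => contraction (sqrmod z j) *: re z j)).
    by rewrite (diff_scale dk dr).2 ek er.
  by apply/funext => y; rewrite re_cscale.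
have [dr er] := dl (rshift n j).
rewrite (_ : (fun y => im (Psi y) j) = (fun z => contraction (sqrmod z j) *: im z j)).
  by rewrite (diff_scale dk dr).2 ek er.
by apply/funext => y; rewrite im_cscale.
Qed.

(** In each plane the radial terms combine through <z,u> z^v - <z,v> z^u = |z|^2 u^v, where ^ is the
    determinant of two vectors; what remains is the Jacobian of [contraction_derive] times u^v. *)
Lemma pullback_Psi z u v : pullback Psi standard_form z u v = cigar_form z u v.
Proof.
apply: eq_bigr => j _.
have [-> ->] := diff_Psi z u j; have [-> ->] := diff_Psi z v j.
rewrite -(contraction_derive (sqrmod_gtN1 z j)) /sqrmod; ring.
Qed.

Lemma symplectomorphism_Psi : symplectomorphism cigar_form standard_form Psi.
Proof.
split; [exact: smooth_Psi| |exact: pullback_Psi].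
by exists Phi; split; [exact: smooth_Phi|exact: PsiK|exact: PhiK].
Qed.

End ComplexVectors.

(** * Second derivatives *)

Section SecondDerivatives.
Context {R : realType}.
Implicit Types (V W : normedModType R).

Lemma diff_cstE V W (a : W) (x u : V) : 'd (fun _ : V => a) x u = 0.
Proof. exact: (congr1 (@^~ u) (diff_cst a x)). Qed.

Lemma diff_ext V W (U : set V) (f g : V -> W) (x u : V) : open U -> U x ->
  (forall y, U y -> f y = g y) -> differentiable f x -> 'd f x u = 'd g x u.
Proof.
move=> oU Ux fg df; have nfg : {near x, f =1 g}.
  by move: (open_nbhs_nbhs (conj oU Ux)); apply: filterS => y; exact: fg.
by rewrite (diff_near_eq nfg df).2.
Qed.

Lemma diff_sumE V W (I : Type) (r : seq I) (f : I -> V -> W) (x : V) :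
  (forall i, differentiable (f i) x) ->
  differentiable (fun y => \sum_(i <- r) f i y) x /\
  forall u : V, 'd (fun y => \sum_(i <- r) f i y) x u = \sum_(i <- r) 'd (f i) x u.
Proof.
move=> df; elim: r => [|i r [IH1 IH2]].
  rewrite (_ : (fun _ => _) = cst 0); last by apply/funext => y; rewrite big_nil.
  by split=> [|u]; [exact: differentiable_cst|rewrite diff_cst big_nil].
have -> : (fun y => \sum_(j <- i :: r) f j y) = (fun y => f i y + \sum_(j <- r) f j y).
  by apply/funext => y; rewrite big_cons.
split=> [|u]; first exact: differentiableD.
by rewrite big_cons -IH2; exact: diff_addE.
Qed.

Lemma diff_linE V W W' (f : V -> W) (l : {linear W -> W'}) (x u : V) :
  continuous l -> differentiable f x ->
  differentiable (fun y => l (f y)) x /\ 'd (fun y => l (f y)) x u = l ('d f x u).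
Proof.
move=> cl df; have dl y : differentiable l y by apply: linear_differentiable.
by split; [exact: (differentiable_comp df)|rewrite (diff_compE _ df (dl _)) diff_lin].
Qed.

Lemma is_derive_line V W (f : V -> W) (x w : V) (t : R) :
  differentiable f (x + t *: w) ->
  is_derive t 1 (fun s => f (x + s *: w)) ('d f (x + t *: w) w).
Proof.
move=> df; have di : differentiable (id : R -> R) t by apply/derivable1_diffP;
  exact: derivable_id.
have dw : differentiable (fun _ : R => w) t by exact: differentiable_cst.
have [d1 e1] := diff_scale di dw.
have dx : differentiable (fun _ : R => x) t by exact: differentiable_cst.
have d2 : differentiable (fun s : R => x + s *: w) t by exact: differentiableD.
have d3 : differentiable (fun s : R => f (x + s *: w)) t.
  exact: (differentiable_comp d2).
apply: DeriveDef; first by apply/derivable1_diffP.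
rewrite deriveE // (diff_compE _ d2 df) (diff_addE _ dx d1) e1.
rewrite !diff_cstE scaler0 !add0r.
by rewrite -(deriveE _ di) derive_id scale1r.
Qed.

Lemma MVT_closed (f df : R -> R) (a b : R) : a < b ->
  (forall x, x \in `[a, b]%R -> is_derive x 1 f (df x)) ->
  exists2 c, c \in `[a, b]%R & f b - f a = df c * (b - a).
Proof.
move=> ab fd; have h1 : a <= b by apply: ltW.
have h2 : forall x, x \in `]a, b[%R -> is_derive x 1 f (df x).
  move=> x xab; apply: fd; move: xab; rewrite !in_itv /=.
  by move=> /andP[/ltW-> /ltW->].
have h3 : {within `[a, b], continuous f}.
  by apply: (@derivable_within_continuous R R f) => x /fd [].
have := @MVT_segment R f df a b h1 h2 h3; exact.
Qed.

Definition D2 V W (f : V -> W) (x u v : V) : W := 'd (fun y => 'd f y u) x v.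

(** The mean value theorem is used twice: along [u] for the increment in [v], then along [v] for the
    derivative in direction [u]. *)
Lemma second_difference V (U : set V) (f : V -> R) (x u v : V) (s : R) : 0 < s ->
  Cr 2 U f -> (forall a b, 0 <= a <= s -> 0 <= b <= s -> U (x + a *: u + b *: v)) ->
  exists a b, [/\ 0 <= a <= s, 0 <= b <= s &
    f (x + s *: u + s *: v) - f (x + s *: u) - f (x + s *: v) + f x =
    D2 f (x + a *: u + b *: v) u v * s * s].
Proof.
move=> s0 [df Cf] hU.
pose phi t := f (x + s *: v + t *: u) - f (x + t *: u).
pose dphi t := 'd f (x + s *: v + t *: u) u - 'd f (x + t *: u) u.
have ss : 0 <= s <= s by rewrite lexx ltW.
have s00 : (0 : R) <= 0 <= s by rewrite lexx ltW.
have [a] : exists2 c, c \in `[0, s]%R & phi s - phi 0 = dphi c * (s - 0).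
  apply: MVT_closed => // t; rewrite in_itv /= => ts.
  apply: is_deriveB; apply: is_derive_line; apply: df.
    by rewrite -addrA [_ *: v + _]addrC addrA; exact: hU.
  by have := hU t 0 ts s00; rewrite scale0r addr0.
rewrite in_itv /= subr0 => sa ea.
have [b] : exists2 c, c \in `[0, s]%R &
    'd f (x + a *: u + s *: v) u - 'd f (x + a *: u + 0 *: v) u =
    D2 f (x + a *: u + c *: v) u v * (s - 0).
  apply: (@MVT_closed (fun t => 'd f (x + a *: u + t *: v) u)) => // t;
    rewrite in_itv /= => ts.
  apply: (@is_derive_line _ _ (fun y => 'd f y u)).
  by have [+ _] := Cf u; apply; exact: hU.
rewrite in_itv /= subr0 scale0r addr0 => sb eb.
exists a, b; split => //; rewrite -eb.
have -> : f (x + s *: u + s *: v) - f (x + s *: u) - f (x + s *: v) + f x =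
    phi s - phi 0.
  by rewrite /phi !scale0r !addr0 [x + s *: v + _]addrAC; ring.
by rewrite ea /dphi [x + s *: v + _]addrAC.
Qed.

(** The second difference is symmetric in [u] and [v], so the two mixed derivatives agree at two
    intermediate points of a small parallelogram; continuity brings both points back to [x]. *)
Lemma D2_sym_scalar V (U : set V) (f : V -> R) (x u v : V) : open U -> U x ->
  Cr 2 U f -> D2 f x u v = D2 f x v u.
Proof.
move=> oU Ux Cf; apply/eqP; rewrite -subr_eq0 -normr_le0.
apply/ler_addgt0Pr => e e0; rewrite add0r.
have e2 : 0 < e / 2 by rewrite divr_gt0.
have Cc (w w' : V) : {for x, continuous (fun y => D2 f y w w')}.
  by have [_ /(_ w) [_ /(_ w')]] := Cf; apply.
have : \forall y \near x, [/\ U y, `|D2 f x u v - D2 f y u v| < e / 2 &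
    `|D2 f x v u - D2 f y v u| < e / 2].
  near=> y; split; near: y; first exact: open_nbhs_nbhs.
    by move: (Cc u v) => /cvgrPdist_lt; exact.
  by move: (Cc v u) => /cvgrPdist_lt; exact.
move=> /nbhs_normP [r /= r0 hr].
(* With this side length the whole parallelogram stays within distance [r / 2] of [x]; the added 1
   keeps the denominator positive when [u] and [v] vanish. *)
pose s := r / (`|u| + `|v| + 1) / 2.
have n0 : 0 < `|u| + `|v| + 1 by rewrite ltr_wpDl ?addr_ge0.
have s0 : 0 < s by rewrite !divr_gt0.
have hs a b : 0 <= a <= s -> 0 <= b <= s -> `|x - (x + a *: u + b *: v)| < r.
  move=> /andP[a0 sa] /andP[b0 sb].
  rewrite -addrA opprD addrA subrr add0r normrN.
  rewrite (le_lt_trans (ler_normD _ _)) // !normrZ !ger0_norm //.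
  have h1 : a * `|u| <= s * `|u| by rewrite ler_wpM2r.
  have h2 : b * `|v| <= s * `|v| by rewrite ler_wpM2r.
  have h3 : s * (`|u| + `|v| + 1) = r / 2.
    by rewrite /s mulrAC divfK // gt_eqF.
  have h4 : 0 < r / 2 by rewrite divr_gt0.
  have h5 : r = r / 2 + r / 2 by rewrite -splitr.
  by rewrite !mulrDr mulr1 in h3; lra.
have [a [b [sa sb eab]]] := second_difference s0 Cf (fun a b ha hb => let: And3 h _
  _ := hr _ (hs a b ha hb) in h).
have hs' a' b' : 0 <= a' <= s -> 0 <= b' <= s -> `|x - (x + a' *: v + b' *: u)| < r.
  by move=> ha hb; rewrite addrAC; exact: hs.
have [a' [b' [sa' sb' eab']]] := second_difference s0 Cf (fun a b ha hb => let:
  And3 h _ _ := hr _ (hs' a b ha hb) in h).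
have [_ h1 _] := hr _ (hs a b sa sb).
have [_ _ h2] := hr _ (hs' a' b' sa' sb').
have E : D2 f (x + a *: u + b *: v) u v = D2 f (x + a' *: v + b' *: u) v u.
  apply: (mulIf (lt0r_neq0 s0)); apply: (mulIf (lt0r_neq0 s0)).
  rewrite -eab -eab' [x + s *: v + s *: u]addrAC; ring.
rewrite E in h1.
rewrite (le_trans (ler_distD (D2 f (x + a' *: v + b' *: u) v u) _ _)) //.
by rewrite (splitr e) lerD // ltW // distrC.
Unshelve. all: by end_near. Qed.

Section Rows.
Context {V : normedModType R} {n : nat}.
Implicit Types (U : set V) (f : V -> 'rV[R]_n).

Lemma D2_coord U f x u v i : open U -> U x -> Cr 2 U f ->
  D2 f x u v 0 i = D2 (fun y => f y 0 i) x u v.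
Proof.
move=> oU Ux [df Cf]; have [dfu _] := Cf u.
have [_ <-] := diff_coord i (dfu x Ux).
apply: (diff_ext v oU Ux) => [y Uy|].
  by have [_ ->] := diff_coord i (df y Uy).
by have [] := diff_coord i (dfu x Ux).
Qed.

Lemma D2_sym U f x u v : open U -> U x -> Cr 2 U f -> D2 f x u v = D2 f x v u.
Proof.
move=> oU Ux Cf; apply/rowP => i; rewrite !(@D2_coord U) //.
by apply: (@D2_sym_scalar _ U) => //; exact: Cr_coord.
Qed.

End Rows.

Lemma D2_linl V W (U : set V) (f : V -> W) x v : U x -> Cr 2 U f ->
  linear (fun u => D2 f x u v).
Proof.
move=> Ux [df Cf] a u u'; rewrite /D2.
have [du _] := Cf u; have [du' _] := Cf u'.
have dc : differentiable (fun _ : V => a) x by exact: differentiable_cst.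
have [d1 e1] := diff_scale dc (du x Ux).
have -> : (fun y => 'd f y (a *: u + u')) = (fun y => a *: 'd f y u + 'd f y u').
  by apply/funext => y; exact: linearP.
apply: (etrans (diff_addE v d1 (du' x Ux))); congr (_ + _).
apply: (etrans (e1 v)); apply: (etrans _ (addr0 _)); congr (_ + _).
by apply: (etrans (congr1 ( *:%R^~ _) (diff_cstE a x v))); exact: scale0r.
Qed.

Lemma D2_linr V W (f : V -> W) x u : linear (D2 f x u).
Proof. by move=> a v v'; rewrite /D2 linearP. Qed.

Lemma linear_delta m W (l : {linear 'rV[R]_m -> W}) (w : 'rV[R]_m) :
  l w = \sum_i w 0 i *: l (delta_mx 0 i).
Proof.
rewrite {1}(row_sum_delta w) linear_sum.
by apply: eq_bigr => i _; rewrite linearZ.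
Qed.

(** The vector [e s] moves with the base point, so it is expanded in the standard basis; the product
    rule then gives one term from the coordinates and one from the base point. *)
Lemma is_derive_diff m W (U : set 'rV[R]_m) (f : 'rV[R]_m -> W)
    (d e : R -> 'rV[R]_m) (t : R) :
  Cr 2 U f -> U (d t) -> differentiable d t -> differentiable e t ->
  is_derive t 1 (fun s => 'd f (d s) (e s))
    ('d f (d t) ('d e t 1) + D2 f (d t) (e t) ('d d t 1)).
Proof.
move=> Cf Udt dd de; have [df Cf1] := Cf.
pose b (i : 'I_m) : 'rV[R]_m := delta_mx 0 i.
have dfb i : differentiable (fun y => 'd f y (b i)) (d t).
  by have [+ _] := Cf1 (b i); apply.
have E : (fun s => 'd f (d s) (e s)) =
    fun s => \sum_i e s 0 i *: 'd f (d s) (b i).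
  by apply/funext => s; exact: linear_delta.
have dc i : differentiable (fun s => e s 0 i) t by have [] := diff_coord i de.
have dg i : differentiable (fun s => 'd f (d s) (b i)) t.
  exact: (differentiable_comp dd (dfb i)).
have ds i : differentiable (fun s => e s 0 i *: 'd f (d s) (b i)) t.
  by have [] := diff_scale (dc i) (dg i).
have [dS eS] := diff_sumE (index_enum 'I_m) ds.
rewrite E; apply: DeriveDef; first by apply/derivable1_diffP.
rewrite (deriveE _ dS) eS.
have E1 := linear_delta ('d f (d t)) ('d e t 1).
have E2 : D2 f (d t) (e t) ('d d t 1) = \sum_i e t 0 i *: D2 f (d t) (b i) ('d d t 1).
  pose l := GRing.isLinear.Build _ _ _ _ (fun u => D2 f (d t) u ('d d t 1))
    (D2_linl ('d d t 1) Udt Cf).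
  pose L : {linear _ -> _} := HB.pack (fun u => D2 f (d t) u ('d d t 1)) l.
  exact: (linear_delta L).
apply: (etrans _ (congr2 +%R (esym E1) (esym E2))).
apply: (etrans _ (big_split _ _ _ _ _)); apply: eq_bigr => i _.
have [_ e1] := diff_scale (dc i) (dg i); have [_ e2] := diff_coord i de.
have e3 := diff_compE (1 : R) dd (dfb i).
apply: (etrans (e1 1)); apply: (etrans (addrC _ _)).
apply: congr2; last exact: (congr1 ( *:%R _) e3).
exact: (congr1 ( *:%R^~ _) (e2 1)).
Qed.

End SecondDerivatives.

Section Holomorphic.
Context {R : realType}.

HB.instance Definition _ n :=
  GRing.isLinear.Build R 'Cx[R]_n 'Cx[R]_n *:%R (@mulI R n) (@mulI_is_linear R n).

Lemma continuous_mulI n : continuous (@mulI R n).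
Proof.
have C : Cr 0 setT (@mulI R n).
  apply: Cr_cx => [|j|j]; first exact: openT.
    apply: (@Cr_ext _ _ _ _ _ (fun z : 'Cx[R]_n => -1 * im z j)); first exact: openT.
      by move=> z _; rewrite re_mulI mulN1r.
    apply: Cr_mul; [exact: openT|exact: Cr_cst|].
    by apply: Cr_im; [exact: openT|exact: Cr_id].
  under eq_fun do rewrite im_mulI.
  exact: (@Cr_re R n 'Cx[R]_n 0 setT id j openT (Cr_id _ _)).
by move=> x; exact: C.
Qed.

(** By symmetry of second derivatives, the derivative of ['d f y v] along [mulI u] is that of
    ['d f y (mulI u)] along [v], where the Cauchy-Riemann equations of [f] apply. *)
Lemma holomorphic_diff k n (U : set 'Cx[R]_k) (f : 'Cx[R]_k -> 'Cx[R]_n) v :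
  open U -> holomorphic U f -> holomorphic U (fun y => 'd f y v).
Proof.
move=> oU [sf hf]; split=> [m|x u Ux]; first by have [_ h] := sf m.+1; exact: h.
have C2 := sf 2; have [df Cf1] := C2.
rewrite -[LHS]/(D2 f x v _) -[in RHS]/(D2 f x v u).
rewrite (D2_sym _ _ oU Ux C2) [in RHS](D2_sym _ _ oU Ux C2).
have [du _] := Cf1 u; have [diu _] := Cf1 (mulI u).
have [_ <-] := diff_linE v (@continuous_mulI n) (du x Ux).
by apply: (diff_ext _ oU Ux) => [y Uy|]; [exact: hf|exact: diu].
Qed.

End Holomorphic.

(** * Geodesics of the product of cigars *)

Section CigarGeodesics.
Context {R : realType}.

Section Metric.
Context {n : nat}.
Implicit Types (z u v w p q r : 'Cx[R]_n) (j : 'I_n).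

(* [p, q, r |-> conj p * q * r / (1 + |p|^2)]; the geodesic equation of the
   cigar metric is [c'' = cigar_acc c c' c']. *)
Definition cigar_acc p q r : 'Cx[R]_n :=
  cscale (fun j => (1 + sqrmod p j)^-1) (cmul (cconj p) (cmul q r)).

Lemma sqrmod1_neq0 z j : 1 + sqrmod z j != 0.
Proof. by rewrite gt_eqF // ltr_wpDr // sqrmod_ge0. Qed.

Lemma diff_inv_sqrmod z v j :
  differentiable (fun y => (1 + sqrmod y j)^-1) z /\
  'd (fun y => (1 + sqrmod y j)^-1) z v =
    - (1 + sqrmod z j) ^- 2 * (2 * (re z j * re v j + im z j * im v j)).
Proof.
have [ds es] := diff_sqrmod z v j.
have dc : differentiable (fun _ : 'Cx[R]_n => 1 : R) z by exact: differentiable_cst.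
have d1 : differentiable (fun y : 'Cx[R]_n => 1 + sqrmod y j) z by exact:
  differentiableD.
split; first by apply: differentiableV => //; exact: sqrmod1_neq0.
apply: (etrans (congr1 (@^~ v) (diffV d1 (sqrmod1_neq0 z j)))).
congr (_ * _); apply: (etrans (diff_addE v dc ds)).
apply: (etrans _ es); apply: (etrans _ (add0r _)); congr (_ + _).
exact: diff_cstE.
Qed.

Lemma derive_cigar_metric z u v w :
  'D_w (fun y => cigar_metric y u v) z =
  \sum_j (re u j * re v j + im u j * im v j) *
    (- (1 + sqrmod z j) ^- 2 * (2 * (re z j * re w j + im z j * im w j))).
Proof.
have dK j : differentiable (fun _ : 'Cx[R]_n => re u j * re v j + im u j * im v j) z.
  exact: differentiable_cst.
have di j := (diff_inv_sqrmod z w j).1.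
have ds j : differentiable (fun y => (re u j * re v j + im u j * im v j) *: (1 +
  sqrmod y j)^-1) z.
  by have [] := diff_scale (dK j) (di j).
have [dS eS] := diff_sumE (index_enum 'I_n) ds.
rewrite (deriveE _ dS) eS; apply: eq_bigr => j _.
apply: (etrans ((diff_scale (dK j) (di j)).2 w)).
apply: (etrans _ (addr0 _)); congr (_ + _).
  by rewrite (diff_inv_sqrmod z w j).2.
transitivity (0 *: ((1 + sqrmod z j)^-1 : R)); last exact: scale0r.
by congr (_ *: _); exact: diff_cstE.
Qed.

(** On each factor the only Christoffel symbol of a Kähler metric is the holomorphic logarithmic
    derivative of its density, here - conj z / (1 + |z|^2). *)
Lemma christoffel_cigar z u w :
  christoffel cigar_metric z u u w = - cigar_metric z (cigar_acc z u u) w.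
Proof.
rewrite /christoffel !derive_cigar_metric /cigar_metric.
rewrite -big_split /= -sumrB mulr_suml -sumrN.
apply: eq_bigr => j _; rewrite !cxE; have := sqrmod1_neq0 z j.
rewrite /sqrmod => h; field; exact: h.
Qed.

Lemma cigar_metric_def z u : cigar_metric z u u = 0 -> u = 0.
Proof.
move=> h; have ge0 j : 0 <= (re u j * re u j + im u j * im u j) / (1 + sqrmod z j).
  by rewrite divr_ge0 ?addr_ge0 ?sqr_ge0 // -?expr2 ?sqr_ge0 // sqrmod_ge0.
have h0 j : (re u j * re u j + im u j * im u j) / (1 + sqrmod z j) = 0.
  by apply: (psumr_eq0P _ h) => // i _; exact: ge0.
apply: cx_ext => j; have /eqP := h0 j; rewrite mulf_eq0 invr_eq0 (negPf
  (sqrmod1_neq0 z j)) orbF -!expr2.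
by rewrite paddr_eq0 ?sqr_ge0 // !sqrf_eq0 !cxE => /andP[/eqP-> /eqP->].
Qed.

Lemma geodesic_cigar (I : set R) (c : R -> 'Cx[R]_n) t :
  geodesic setT cigar_metric I c -> I t ->
  c^`()^`()%classic t = cigar_acc (c t) (c^`()%classic t) (c^`()%classic t).
Proof.
move=> [_ _ h] It; apply/eqP; rewrite -subr_eq0; apply/eqP.
(* The geodesic equation is tested against the difference [w] itself, and the metric is definite. *)
apply: (@cigar_metric_def (c t)); set w := _ - _.
have := h t w It; rewrite christoffel_cigar /cigar_metric -sumrN -big_split /=.
move=> e; rewrite -[RHS]e; apply: eq_bigr => j _.
rewrite {1}/w {2}/w reD imD reN imN; field.
exact: sqrmod1_neq0.
Qed.

End Metric.

Section Calculus1.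
Implicit Types (f g : R -> R) (t : R).

Lemma der_mul f g t df dg : is_derive t 1 f df -> is_derive t 1 g dg ->
  is_derive t 1 (fun s => f s * g s) (df * g t + f t * dg).
Proof.
move=> hf hg; have h := is_deriveM hf hg.
by apply: (is_derive_eq h); rewrite /GRing.scale /= addrC mulrC.
Qed.

Lemma der_add f g t df dg : is_derive t 1 f df -> is_derive t 1 g dg ->
  is_derive t 1 (fun s => f s + g s) (df + dg).
Proof. by move=> hf hg; exact: is_deriveD. Qed.

Lemma der_sub f g t df dg : is_derive t 1 f df -> is_derive t 1 g dg ->
  is_derive t 1 (fun s => f s - g s) (df - dg).
Proof. by move=> hf hg; exact: is_deriveB. Qed.

Lemma der_inv f t df : f t != 0 -> is_derive t 1 f df ->
  is_derive t 1 (fun s => (f s)^-1) (- df / f t ^+ 2).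
Proof.
move=> f0 hf; have h := is_deriveV f0 hf; apply: (is_derive_eq h).
by rewrite /GRing.scale /= mulNr mulrC mulNr.
Qed.

Lemma der_exp (a t : R) : is_derive t 1 (fun s => expR (a * s)) (a * expR (a * t)).
Proof.
have h : is_derive t 1 (fun s : R => a * s) a.
  have h0 := der_mul (is_derive_cst a t 1) (is_derive_id t 1).
  by apply: (is_derive_eq h0); rewrite mul0r add0r mulr1.
have h1 := is_derive1_comp (is_derive_expR (a * t)) h.
by apply: (is_derive_eq h1); rewrite mulrC.
Qed.

Lemma der_cst_eq f s t : (forall u : R, is_derive u 1 f 0) -> f s = f t.
Proof. exact: is_derive_0_is_cst. Qed.

End Calculus1.

(** * Planar cigar geodesics issuing from the origin *)

Section RadialODE.
Variables (x y x1 y1 : R -> R).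
Let D t := 1 + (x t * x t + y t * y t).
Let K t := x1 t * x1 t + y1 t * y1 t.
Let L t := x t * y1 t - y t * x1 t.
Hypothesis dx : forall t : R, is_derive t 1 x (x1 t).
Hypothesis dy : forall t : R, is_derive t 1 y (y1 t).
(** The numerator is the real part of conj z * z'^2, since conj z * z' + z * conj z' = 2 <z,z'>. *)
Hypothesis dx1 : forall t : R, is_derive t 1 x1
  ((2 * (x t * x1 t + y t * y1 t) * x1 t - K t * x t) / D t).
Hypothesis dy1 : forall t : R, is_derive t 1 y1
  ((2 * (x t * x1 t + y t * y1 t) * y1 t - K t * y t) / D t).
Hypothesis x0 : x 0 = 0.
Hypothesis y0 : y 0 = 0.

Let D0 t : D t != 0.
Proof. by rewrite gt_eqF // ltr_wpDr // addr_ge0 // -expr2 sqr_ge0. Qed.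

Let dD (t : R) : is_derive t 1 D (0 + ((x1 t * x t + x t * x1 t) + (y1 t * y t + y
  t * y1 t))).
Proof.
exact: (der_add (is_derive_cst (1 : R) t 1)
  (der_add (der_mul (dx t) (dx t)) (der_mul (dy t) (dy t)))).
Qed.

(** Conservation of speed: K / D is the squared cigar length of the velocity, and D = 1 at the
    origin. *)
Let energy t : K t = K 0 * D t.
Proof.
have h (s : R) : is_derive s 1 (fun s => K s * (D s)^-1) 0.
  have h := der_mul (der_add (der_mul (dx1 s) (dx1 s)) (der_mul (dy1 s) (dy1 s)))
    (der_inv (D0 s) (dD s)).
  by apply: (is_derive_eq h); rewrite -/(K s); have := D0 s; rewrite /K /D => d0; field.
have := der_cst_eq t 0 h; rewrite {2}/D x0 y0 !mul0r !addr0 invr1 mulr1 => <-.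
by rewrite divfK // D0.
Qed.

(** L / D is the angular momentum conserved by rotations; it vanishes because the curve passes
    through the origin. *)
Let momentum t : L t = 0.
Proof.
have h (s : R) : is_derive s 1 (fun s => L s * (D s)^-1) 0.
  have h := der_mul (der_sub (der_mul (dx s) (dy1 s)) (der_mul (dy s) (dx1 s)))
    (der_inv (D0 s) (dD s)).
  by apply: (is_derive_eq h); rewrite -/(L s); have := D0 s;
    rewrite /K /L /D => d0; field.
have := der_cst_eq t 0 h; rewrite {2}/L x0 y0 !mul0r subr0 mul0r => /eqP.
by rewrite mulf_eq0 invr_eq0 (negPf (D0 t)) orbF => /eqP.
Qed.

(** Without angular momentum, conj z * z'^2 reduces to |z'|^2 z, and conservation of speed makes the
    equation linear: z'' = K(0) z. *)
Lemma radial_acc (t : R) : is_derive t 1 x1 (K 0 * x t).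
Proof.
apply: (is_derive_eq (dx1 t)).
have -> : 2 * (x t * x1 t + y t * y1 t) * x1 t - K t * x t = K t * x t - 2 * y1 t * L t.
  by rewrite /K /L; ring.
by rewrite momentum mulr0 subr0 energy mulrAC mulfK // D0.
Qed.

(** The operator x'' - a^2 x factors, so x' + b x = x'(0) e^(bt) for b = a and b = -a; subtracting
    the two eliminates x'. For a = 0 this says nothing, and the second clause comes from the
    vanishing of the speed. *)
Lemma radial_solution a t : a ^+ 2 = x1 0 ^+ 2 + y1 0 ^+ 2 ->
  2 * a * x t = x1 0 * (expR (a * t) - expR (- a * t)) /\ (a = 0 -> x t = 0).
Proof.
move=> ha; have K0 : K 0 = a * a by rewrite -expr2 ha /K !expr2.
have da (b s : R) : is_derive s 1 (fun s => b * x s) (b * x1 s).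
  have h := der_mul (is_derive_cst b s 1) (dx s).
  by apply: (is_derive_eq h); rewrite mul0r add0r.
have hc (b : R) : b * b = a * a -> x1 t + b * x t = x1 0 * expR (b * t).
  move=> bb; have h (s : R) : is_derive s 1 (fun s => (x1 s + b * x s) * expR (- b
    * s)) 0.
    have h := der_mul (der_add (radial_acc s) (da b s)) (der_exp (- b) s).
    by apply: (is_derive_eq h); rewrite K0 -bb; ring.
  have := der_cst_eq t 0 h; rewrite !mulr0 x0 mulr0 addr0 expR0 mulr1 => <-.
  by rewrite -mulrA -expRD mulNr addNr expR0 mulr1.
split=> [|a0].
  rewrite mulrBr -(hc a) // -(hc (- a)) ?mulrNN //; ring.
have K00 : K 0 = 0 by rewrite K0 a0 mulr0.
have h1 s : x1 s = 0.
  apply/eqP; have := energy s; rewrite K00 mul0r /K -!expr2 => /eqP.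
  by rewrite paddr_eq0 ?sqr_ge0 // !sqrf_eq0 => /andP[].
have h (s : R) : is_derive s 1 x 0 by apply: (is_derive_eq (dx s)); exact: h1.
by rewrite (der_cst_eq t 0 h).
Qed.

End RadialODE.

Section Radial.
Context {n : nat}.
Implicit Types (z v : 'Cx[R]_n) (c : R -> 'Cx[R]_n) (j : 'I_n).

Lemma is_derive_re c (t : R) j : differentiable c t ->
  is_derive t 1 (fun s => re (c s) j) (re (c^`()%classic t) j) /\
  is_derive t 1 (fun s => im (c s) j) (im (c^`()%classic t) j).
Proof.
move=> dc; rewrite derive1E'//; have [dr er] := diff_coord (lshift n j) dc.
have [di ei] := diff_coord (rshift n j) dc.
split; apply: DeriveDef.
- exact/derivable1_diffP.
- by rewrite (deriveE _ dr); exact: er.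
- exact/derivable1_diffP.
- by rewrite (deriveE _ di); exact: ei.
Qed.

Lemma derive1_diff (W : normedModType R) (c : R -> W) :
  (forall t, differentiable c t) -> c^`()%classic = (fun t => 'd c t 1).
Proof. by move=> dc; apply/funext => t; rewrite derive1E'. Qed.

(** This is arcsinh r / r with r the square root of [s]; arcsinh r is the cigar distance from 0 to a
    point of modulus r. At [s = 0] the division convention gives 0, which is harmless since it
    multiplies a zero coordinate. *)
Definition arclength (s : R) : R :=
  ln (Num.sqrt s + Num.sqrt (1 + s)) / Num.sqrt s.

(** The geodesic equation decouples over the factors. On factor [j] the initial speed is arcsinh
    |z_j|, and its hyperbolic sine returns |z_j| at time 1. *)
Lemma radial_geodesic c z : geodesic setT cigar_metric setT c -> c 0 = 0 ->
  c^`()%classic 0 = cscale (fun j => arclength (sqrmod z j)) z -> c 1 = z.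
Proof.
move=> gc c0 c1; have [sc _ _] := gc.
have dc (t : R) : differentiable c t by have [/(_ t I)] := sc 2.
have dc1 (t : R) : differentiable (c^`()%classic) t.
  by rewrite (derive1_diff dc); have [_ /(_ 1) [/(_ t I)]] := sc 2.
apply: cx_ext => j.
set s := sqrmod z j; pose a := arclength s * Num.sqrt s.
have s0 : 0 <= s by exact: sqrmod_ge0.
have ha : a ^+ 2 = re (c^`()%classic 0) j ^+ 2 + im (c^`()%classic 0) j ^+ 2.
  by rewrite c1 !cxE -/s exprMn sqr_sqrtr // /s /sqrmod; ring.
have E t : c^`()^`()%classic t = cigar_acc (c t) (c^`()%classic t) (c^`()%classic t).
  exact: (geodesic_cigar gc).
pose x t := re (c t) j; pose y t := im (c t) j.
pose x1 t := re (c^`()%classic t) j; pose y1 t := im (c^`()%classic t) j.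
have dx (t : R) : is_derive t 1 x (x1 t) by have [] := is_derive_re j (dc t).
have dy (t : R) : is_derive t 1 y (y1 t) by have [] := is_derive_re j (dc t).
have D0 t : 1 + (x t * x t + y t * y t) != 0.
  by have := sqrmod1_neq0 (c t) j; rewrite /sqrmod !expr2.
have dx1 (t : R) : is_derive t 1 x1 ((2 * (x t * x1 t + y t * y1 t) * x1 t -
    (x1 t * x1 t + y1 t * y1 t) * x t) / (1 + (x t * x t + y t * y t))).
  have [h _] := is_derive_re j (dc1 t); apply: (is_derive_eq h).
  rewrite E !cxE /sqrmod !expr2 -/(x t) -/(y t) -/(x1 t) -/(y1 t).
  by move: (D0 t) => d0; field.
have dy1 (t : R) : is_derive t 1 y1 ((2 * (x t * x1 t + y t * y1 t) * y1 t -
    (x1 t * x1 t + y1 t * y1 t) * y t) / (1 + (x t * x t + y t * y t))).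
  have [_ h] := is_derive_re j (dc1 t); apply: (is_derive_eq h).
  rewrite E !cxE /sqrmod !expr2 -/(x t) -/(y t) -/(x1 t) -/(y1 t).
  by move: (D0 t) => d0; field.
have x0 : x 0 = 0 by rewrite /x c0 cxE.
have y0 : y 0 = 0 by rewrite /y c0 cxE.
have [ex ex'] := radial_solution dx dy dx1 dy1 x0 y0 1 ha.
(* The system is invariant under exchanging [x] and [y], so the imaginary part is obtained from the
   same lemma with the roles swapped. *)
have dx1' (t : R) : is_derive t 1 y1 ((2 * (y t * y1 t + x t * x1 t) * y1 t -
    (y1 t * y1 t + x1 t * x1 t) * y t) / (1 + (y t * y t + x t * x t))).
  apply: (is_derive_eq (dy1 t)); rewrite [y t * y t + _]addrC.
  by congr (_ / _); ring.
have dy1' (t : R) : is_derive t 1 x1 ((2 * (y t * y1 t + x t * x1 t) * x1 t -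
    (y1 t * y1 t + x1 t * x1 t) * x t) / (1 + (y t * y t + x t * x t))).
  apply: (is_derive_eq (dx1 t)); rewrite [y t * y t + _]addrC.
  by congr (_ / _); ring.
rewrite addrC in ha.
have [ey ey'] := radial_solution dy dx dx1' dy1' y0 x0 1 ha.
rewrite -/(x 1) -/(y 1).
have [sz|sz] := eqVneq s 0.
  have a0 : a = 0 by rewrite /a sz sqrtr0 mulr0.
  rewrite (ex' a0) (ey' a0); have /eqP := sz.
  by rewrite /s /sqrmod paddr_eq0 ?sqr_ge0 // !sqrf_eq0 => /andP[/eqP-> /eqP->].
have sp : 0 < s by rewrite lt_def sz.
have r0 : 0 < Num.sqrt s by rewrite sqrtr_gt0.
have r1 : 1 <= Num.sqrt (1 + s).
  by rewrite -[X in X <= _]sqrtr1 ler_wsqrtr // lerDl.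
have ae : a = ln (Num.sqrt s + Num.sqrt (1 + s)) by rewrite /a divfK // gt_eqF.
have ap : 0 < a by rewrite ae ln_gt0 // -[X in X < _]add0r ltr_leD.
have ea : expR a = Num.sqrt s + Num.sqrt (1 + s).
  by rewrite ae lnK // posrE addr_gt0 // (lt_le_trans ltr01).
(* The two roots have difference of squares 1, so the conjugate expression is the inverse. *)
have eN : expR (- a) = Num.sqrt (1 + s) - Num.sqrt s.
  rewrite expRN ea; apply: (mulfI (x := Num.sqrt s + Num.sqrt (1 + s))).
    by rewrite -ea gt_eqF // expR_gt0.
  rewrite divff; last by rewrite -ea gt_eqF // expR_gt0.
  have h1 : 0 <= 1 + s by rewrite addr_ge0.
  by rewrite mulrC [Num.sqrt s + _]addrC -subr_sqr (sqr_sqrtr h1) (sqr_sqrtr s0); ring.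
have ed : expR (a * 1) - expR (- a * 1) = 2 * Num.sqrt s.
  by rewrite !mulr1 ea eN; ring.
have a2 : 2 * a != 0 by rewrite mulf_neq0 ?pnatr_eq0 // gt_eqF.
split; apply: (mulfI a2).
  by rewrite ex ed /x1 c1 !cxE -/s /a; ring.
by rewrite ey ed /y1 c1 !cxE -/s /a; ring.
Qed.

End Radial.
End CigarGeodesics.

(** * Triple systems *)

Section TripleSystem.
Context {R : realType} {n : nat}.
Implicit Types (u v w x p q r z : 'Cx[R]_n) (d : 'I_n -> R) (j : 'I_n).

Variable T : set 'Cx[R]_n.
Hypothesis T_complex : complex_linear_subspace T.
Hypothesis T_triple : forall u w, T u -> T w -> T (cmul (cconj w) (cmul u u)).

Lemma csub0 : T 0. Proof. by have [] := T_complex. Qed.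

Lemma csubD u v : T u -> T v -> T (u + v).
Proof. by have [_ h _] := T_complex; exact: h. Qed.

Lemma csubZ a u : T u -> T (a *: u).
Proof.
by move=> Tu; have [_ _ /(_ a 0 u Tu)] := T_complex; rewrite scale0r addr0.
Qed.

Lemma csubI u : T u -> T (mulI u).
Proof.
by move=> Tu; have [_ _ /(_ 0 1 u Tu)] := T_complex; rewrite scale0r scale1r add0r.
Qed.

Lemma csubB u v : T u -> T v -> T (u - v).
Proof. by move=> Tu Tv; rewrite -scaleN1r; apply: csubD => //; exact: csubZ. Qed.

Lemma triple_polar u v w : T u -> T v -> T w -> T (cmul (cconj w) (cmul u v)).
Proof.
move=> Tu Tv Tw.
have -> : cmul (cconj w) (cmul u v) = 2^-1 *: (cmul (cconj w) (cmul (u + v) (u + v))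
    - cmul (cconj w) (cmul u u) - cmul (cconj w) (cmul v v)).
  by apply: cx_ext => j; rewrite !cxE; split; field.
by apply: csubZ; apply: csubB; [apply: csubB|]; apply: T_triple => //; exact: csubD.
Qed.

(** The real diagonal operators that preserve [T]; they form an algebra, which makes polynomial
    interpolation available. *)
Definition multiplier d := forall x, T x -> T (cscale d x).

Lemma multiplier_cst (a : R) : multiplier (fun=> a).
Proof.
move=> x Tx; have -> : cscale (fun=> a) x = a *: x; last exact: csubZ.
by apply: cx_ext => j; rewrite !cxE.
Qed.

Lemma multiplierD d d' : multiplier d -> multiplier d' -> multiplier (fun j => d j
  + d' j).
Proof.
move=> hd hd' x Tx.
have -> : cscale (fun j => d j + d' j) x = cscale d x + cscale d' x.
  by apply: cx_ext => j; rewrite !cxE !mulrDl.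
by apply: csubD; [exact: hd|exact: hd'].
Qed.

Lemma multiplierM d d' : multiplier d -> multiplier d' -> multiplier (fun j => d j
  * d' j).
Proof. by move=> hd hd' x Tx; rewrite -cscaleA; apply/hd/hd'. Qed.

Lemma multiplier_sum (I : Type) (s : seq I) (P : pred I) (F : I -> 'I_n -> R) :
  (forall i, multiplier (F i)) -> multiplier (fun j => \sum_(i <- s | P i) F i j).
Proof.
move=> hF; elim: s => [|i s IH].
  by under eq_fun do rewrite big_nil; exact: multiplier_cst.
under eq_fun do rewrite big_cons; case: (P i) => //.
exact: multiplierD.
Qed.

Lemma multiplier_prod (I : Type) (s : seq I) (P : pred I) (F : I -> 'I_n -> R) :
  (forall i, multiplier (F i)) -> multiplier (fun j => \prod_(i <- s | P i) F i j).
Proof.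
move=> hF; elim: s => [|i s IH].
  by under eq_fun do rewrite big_nil; exact: multiplier_cst.
under eq_fun do rewrite big_cons; case: (P i) => //.
exact: multiplierM.
Qed.

(** Coordinatewise |u|^2 x = conj u * (u * x), a polarized triple product. *)
Lemma multiplier_sqrmod u : T u -> multiplier (sqrmod u).
Proof.
move=> Tu x Tx; have -> : cscale (sqrmod u) x = cmul (cconj u) (cmul u x).
  by apply: cx_ext => j; rewrite !cxE /sqrmod; split; ring.
exact: triple_polar.
Qed.

(* Lagrange interpolation at the finitely many values of [|u_j|^2]. *)
Lemma multiplier_fun u (F : R -> R) : T u -> multiplier (fun j => F (sqrmod u j)).
Proof.
move=> Tu; pose s := undup [seq sqrmod u j | j <- enum 'I_n].
have us : uniq s by exact: undup_uniq.
have E : (fun j => F (sqrmod u j)) = fun j =>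
    \sum_(a <- s) F a * \prod_(b <- s | b != a) ((sqrmod u j - b) * (a - b)^-1).
  apply/funext => j; have js : sqrmod u j \in s.
    by rewrite mem_undup; apply/mapP; exists j => //; rewrite mem_enum.
  rewrite (bigD1_seq (sqrmod u j)) //= [X in _ + X]big1_seq ?addr0.
    rewrite big1 ?mulr1 // => b bj; rewrite divff // subr_eq0 eq_sym //.
  move=> a /andP[aj _]; rewrite (big_rem (sqrmod u j)) //= eq_sym aj.
  by rewrite subrr !mul0r mulr0.
rewrite E; apply: multiplier_sum => a; apply: multiplierM; first exact: multiplier_cst.
apply: multiplier_prod => b; apply: multiplierM; last exact: multiplier_cst.
by apply: multiplierD; [exact: multiplier_sqrmod|exact: multiplier_cst].
Qed.

Lemma csub_cigar_acc p q r : T p -> T q -> T r -> T (cigar_acc p q r).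
Proof.
move=> Tp Tq Tr; apply: (multiplier_fun (fun s => (1 + s)^-1) Tp).
exact: triple_polar.
Qed.

Lemma csub_Psi z : T z -> T (Psi z).
Proof. by move=> Tz; exact: (multiplier_fun contraction Tz). Qed.

Lemma csub_Phi z : T z -> T (Phi z).
Proof. by move=> Tz; exact: (multiplier_fun dilation Tz). Qed.

(** [Psi] is not linear, but at each [z] in [T] it acts as a multiplier built from [z] itself; the
    same holds for its inverse [Phi], which gives surjectivity. *)
Lemma Psi_csub : Psi @` T = T.
Proof.
apply/seteqP; split=> [_ [z Tz <-]|z Tz]; first exact: csub_Psi.
by exists (Phi z); [exact: csub_Phi|exact: PhiK].
Qed.

End TripleSystem.

(** * The second fundamental form *)

Section OpenPreimage.
Context {R : realType}.

Lemma open_preimage_in (V W : normedModType R) (U : set V) (f : V -> W) (O : set W) :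
  open U -> (forall x, U x -> {for x, continuous f}) -> open O ->
  open (U `&` (f @^-1` O)).
Proof.
move=> oU cf oO; rewrite openE => x [Ux Ofx].
apply: filterI; first exact: open_nbhs_nbhs.
exact: (cf x Ux) _ (open_nbhs_nbhs (conj oO Ofx)).
Qed.

End OpenPreimage.

Lemma polar_identity (R : realType) n (a b c : 'rV[R]_n) :
  a + b + (b + c) - a - c = 2 *: b.
Proof. by apply/rowP => i; rewrite !mxE; ring. Qed.

Lemma sub_shuffle (R : realType) n (a b c d e f : 'rV[R]_n) :
  a - b - c - (d - e - f) = a - d - (b - e) - (c - f).
Proof. by apply/rowP => i; rewrite !mxE; ring. Qed.

Section SecondFundamentalForm.
Context {R : realType} {k n : nat}.
Variables (S : set 'Cx[R]_n) (A : set (param R k n)).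
Hypothesis S_submanifold : complex_submanifold S A.

(** Differentiating [phi = psi o tau] shows that the tangent space at a point does not depend on the
    chart. *)
Lemma chart_transition phi psi x y : A phi -> A psi -> pdom phi x -> pdom psi y ->
  phi x = psi y -> forall u, exists w, 'd phi x u = 'd psi y w.
Proof.
move=> Aphi Apsi Ux Uy e u.
have [hA _ hT] := S_submanifold.
have [oU [sphi _] iphi _ _] := hA _ Aphi.
have [oU' [spsi _] ipsi _ _] := hA _ Apsi.
have [oO [tau [stau _] htau]] := hT _ _ Aphi Apsi.
have Ox : overlap phi psi x by split=> //; exists y.
have [Utx etx] := htau x Ox.
have ty : tau x = y by apply: ipsi; rewrite ?inE // etx.
exists ('d tau x u); rewrite -ty.
have dtau : differentiable tau x by have [/(_ x Ox)] := stau 1.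
have dpsi : differentiable psi (tau x) by rewrite ty; have [/(_ y Uy)] := spsi 1.
apply: (etrans _ (diff_compE u dtau dpsi)).
apply: (diff_ext u oO Ox); last by have [/(_ x Ux)] := sphi 1.
by move=> z Oz; have [_ ->] := htau z Oz.
Qed.

Hypothesis S_complete : submanifold_complete A cigar_metric.
Hypothesis S_tg : totally_geodesic A cigar_metric.

Lemma submanifold_geodesic_sub g (I : set R) gam t :
  submanifold_geodesic A g I gam -> I t -> S (gam t).
Proof.
move=> sg It; have [psi [J [c [Apsi [_ _ Jt _] [_ cU _] e]]]] := sg t It.
have [hA _ _] := S_submanifold; have [_ _ _ _ sub] := hA _ Apsi.
by rewrite (e t Jt); apply: sub; exists (c t) => //; exact: cU.
Qed.

Lemma submanifold_geodesic_ambient phi x v : A phi -> pdom phi x ->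
  exists gam, [/\ submanifold_geodesic A cigar_metric setT gam,
    geodesic setT cigar_metric setT gam, gam 0 = phi x &
    gam^`()%classic 0 = 'd phi x v].
Proof.
move=> Aphi Ux; have [gam [sg g0 g1]] := S_complete v Aphi Ux.
exists gam; split=> //; apply: S_tg sg; first exact: openT.
by [].
Qed.

(** The geodesic of [S] with velocity ['d phi x v] is also an ambient geodesic, so its second
    derivative is [cigar_acc]. In the chart it is [phi o d], whose second derivative is
    [D2 phi x v v] plus the tangent vector ['d phi x d'']. *)
Lemma second_fundamental_diag phi x v : A phi -> pdom phi x ->
  exists a, D2 phi x v v - cigar_acc (phi x) ('d phi x v) ('d phi x v) = 'd phi x a.
Proof.
move=> Aphi Ux; have [gam [sg gg g0 g1]] := submanifold_geodesic_ambient v Aphi Ux.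
have [psi [J [c [Apsi [oJ _ J0 _] [sc cU _] ec]]]] := sg 0 I.
have [hA _ hT] := S_submanifold.
have [oU [sphi _] iphi injphi _] := hA _ Aphi.
have [oO [tau [stau _] htau]] := hT _ _ Apsi Aphi.
have [sgam _ _] := gg.
(* The geodesic is given in some chart [psi] around the point; it is moved to [phi] by [tau] on the
   times at which it stays in the overlap. *)
pose O := J `&` (c @^-1` overlap psi phi).
have oO' : open O by apply: open_preimage_in => //; exact: (sc 0).
have O0 : O 0.
  split=> //; split; first exact: cU.
  by exists x => //; rewrite -g0; exact: ec.
pose d t := tau (c t).
have Cd m : Cr m O d.
  have sO : O `<=` J by move=> t [].
  have hO t : O t -> overlap psi phi (c t) by move=> [].
  exact: (Cr_comp oO' hO (Cr_sub sO (sc m)) (stau m)).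
have dU t : O t -> pdom phi (d t) by move=> [Jt Ot]; have [] := htau _ Ot.
have dE t : O t -> phi (d t) = gam t.
  by move=> [Jt Ot]; have [_ ->] := htau _ Ot; rewrite -ec.
have d0 : d 0 = x by apply: iphi; rewrite ?inE //; [exact: dU|rewrite dE].
clearbody d.
have ddif t : O t -> differentiable d t by move=> Ot; have [/(_ t Ot)] := Cd 1.
have gdif t : differentiable gam t by have [/(_ t I)] := sgam 1.
have g'E t : O t -> gam^`()%classic t = 'd phi (d t) ('d d t 1).
  move=> Ot; rewrite derive1E' //.
  have dphi : differentiable phi (d t) by have [/(_ _ (dU t Ot))] := sphi 1.
  have <- := diff_compE (1 : R) (ddif t Ot) dphi.
  by apply: (diff_ext (1 : R) oO' Ot) => // s Os; rewrite dE.
have d'0 : 'd d 0 1 = v.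
  by apply: (injphi x Ux); have := g'E 0 O0; rewrite d0 g1.
have dd'0 : differentiable (fun t => 'd d t 1) 0.
  by have [_ /(_ 1) [/(_ 0 O0)]] := Cd 2.
have key p w : d 0 = p -> 'd d 0 1 = w ->
    is_derive (0 : R) 1 (fun s => 'd phi (d s) ('d d s 1))
      ('d phi p ('d (fun t => 'd d t 1) 0 1) + D2 phi p w w).
  by move=> <- <-; exact: (is_derive_diff (sphi 2) (dU 0 O0) (ddif 0 O0) dd'0).
have h := key x v d0 d'0.
have h2 : is_derive (0 : R) 1 (gam^`()%classic)
    ('d phi x ('d (fun t => 'd d t 1) 0 1) + D2 phi x v v).
  apply: near_eq_is_derive h; move: (open_nbhs_nbhs (conj oO' O0)).
  by apply: filterS => t Ot; rewrite g'E.
have := geodesic_cigar gg (t := 0) I.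
rewrite derive1E; have [_ ->] := h2; rewrite g0 g1 => <-.
exists (- 'd (fun t => 'd d t 1) 0 1).
by rewrite linearN opprD addrC addrNK.
Qed.

Lemma cigar_acc_polar (p q r : 'Cx[R]_n) :
  cigar_acc p (q + r) (q + r) - cigar_acc p q q - cigar_acc p r r = 2 *: cigar_acc
    p q r.
Proof. by apply: cx_ext => j; rewrite !cxE; split; ring. Qed.

Lemma D2_polar phi x u v : A phi -> pdom phi x ->
  D2 phi x (u + v) (u + v) - D2 phi x u u - D2 phi x v v = 2 *: D2 phi x u v.
Proof.
move=> Aphi Ux; have [hA _ _] := S_submanifold.
have [oU [sphi _] _ _ _] := hA _ Aphi.
have hl a b w : D2 phi x (a + b) w = D2 phi x a w + D2 phi x b w.
  by have := D2_linl w Ux (sphi 2) 1 a b; rewrite !scale1r.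
have hr a b w : D2 phi x w (a + b) = D2 phi x w a + D2 phi x w b.
  by have := D2_linr phi x w 1 a b; rewrite !scale1r.
rewrite hl !hr (D2_sym v u oU Ux (sphi 2)).
exact: polar_identity.
Qed.

(** Both [D2 phi x] and [cigar_acc (phi x)] are symmetric bilinear, so the diagonal case
    polarizes. *)
Lemma second_fundamental phi x u v : A phi -> pdom phi x ->
  exists a, D2 phi x u v - cigar_acc (phi x) ('d phi x u) ('d phi x v) = 'd phi x a.
Proof.
move=> Aphi Ux.
have [a ea] := second_fundamental_diag u Aphi Ux.
have [b eb] := second_fundamental_diag v Aphi Ux.
have [c ec] := second_fundamental_diag (u + v) Aphi Ux.
have e1 := D2_polar u v Aphi Ux.
have e2 := cigar_acc_polar (phi x) ('d phi x u) ('d phi x v).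
have e3 : 'd phi x (u + v) = 'd phi x u + 'd phi x v by exact: linearD.
rewrite e3 in ec.
exists (2^-1 *: (c - a - b)).
have -> : 'd phi x (2^-1 *: (c - a - b)) = 2^-1 *: ('d phi x c - 'd phi x a - 'd
  phi x b).
  apply: (etrans (linearZ _ _)); congr (_ *: _).
  by apply: (etrans (linearB _ _ _)); congr (_ - _); exact: linearB.
apply: (scalerI (a := 2)); first by rewrite pnatr_eq0.
rewrite scalerBr -e1 -e2 scalerA divff ?pnatr_eq0 // scale1r -ea -eb -ec.
exact: sub_shuffle.
Qed.

End SecondFundamentalForm.

(** * Linear bounds and Gronwall's inequality *)

Section LinearBounds.
Context {R : realType}.

Lemma coord_le_norm n (v : 'rV[R]_n) j : `|v 0 j| <= `|v|.
Proof.
rewrite [leRHS]/Num.Def.normr /= mx_normrE.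
exact: (le_bigmax _ (fun ij : 'I_1 * 'I_n => `|v ij.1 ij.2|) (0, j)).
Qed.

Lemma norm_le_coord n (v : 'rV[R]_n) (c : R) : 0 <= c ->
  (forall j, `|v 0 j| <= c) -> `|v| <= c.
Proof.
move=> c0 h; rewrite /Num.Def.normr /= mx_normrE bigmax_le //= => -[i j] _ /=.
by rewrite ord1.
Qed.

Lemma norm_le_sum n (v : 'rV[R]_n) : `|v| <= \sum_j `|v 0 j|.
Proof.
apply: norm_le_coord => [|j]; first exact: sumr_ge0.
by rewrite (bigD1 j) //= lerDl sumr_ge0.
Qed.

Lemma linear_norm_le m (V W : normedModType R) (l : {linear 'rV[R]_m -> V})
    (N : {linear V -> W}) a :
  `|N (l a)| <= `|a| * \sum_i `|N (l (delta_mx 0 i))|.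
Proof.
rewrite linear_delta linear_sum (le_trans (ler_norm_sum _ _ _)) // mulr_sumr.
by apply: ler_sum => i _; rewrite linearZ normrZ ler_wpM2r // coord_le_norm.
Qed.

Lemma linear_dist_le m (V : normedModType R) (l l' : {linear 'rV[R]_m -> V}) a :
  `|l a - l' a| <= `|a| * \sum_i `|l (delta_mx 0 i) - l' (delta_mx 0 i)|.
Proof.
rewrite linear_delta (linear_delta l') -sumrB (le_trans (ler_norm_sum _ _ _)) //.
rewrite mulr_sumr; apply: ler_sum => i _.
by rewrite -scalerBr normrZ ler_wpM2r // coord_le_norm.
Qed.

Lemma linear_continuous_rV n (W : normedModType R) (l : {linear 'rV[R]_n -> W}) :
  continuous l.
Proof.
have C : Cr 0 setT l.
  apply: (@Cr_ext R 0 'rV[R]_n W setT (fun w => \sum_i w 0 i *: l (delta_mx 0 i)));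
    first exact: openT.
    by move=> w _; rewrite -linear_delta.
  apply: Cr_sum => [|i]; first exact: openT.
  apply: Cr_scale; [exact: openT| |exact: Cr_cst].
  exact: (@Cr_linear _ 0 _ _ setT (@rowc R n i) (@rowc_continuous R n i)).
by move=> x; exact: C.
Qed.

(** [N] is the complement of the projection onto the row space given by the pseudo-inverse. Its
    kernel is the range of [f], and [v - N v] is the component of [v] in that range. *)
Lemma linear_range_defect m n (f : {linear 'rV[R]_m -> 'rV[R]_n}) :
  exists N : {linear 'rV[R]_n -> 'rV[R]_n},
    (forall v, N v = 0 <-> exists u, v = f u) /\ (forall v, N (v - N v) = 0).
Proof.
pose M := lin1_mx f; pose P := pinvmx M *m M.
have fM u : f u = u *m M by rewrite mul_rV_lin1.
have PE v : (exists u, v = f u) -> v *m P = v.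
  move=> [u ->]; rewrite fM /P mulmxA; apply: mulmxKpV; exact: submxMl.
exists (mulmxr (1%:M - P)).
have NE (v : 'rV[R]_n) : v *m (1%:M - P) = v - v *m P by rewrite mulmxBr mulmx1.
have NP v : (exists u, v = f u) -> v *m (1%:M - P) = 0.
  by move=> /PE h; rewrite NE h subrr.
split=> v /=.
  split; last exact: NP.
  rewrite NE => /eqP; rewrite subr_eq0 => /eqP ->.
  by exists (v *m pinvmx M); rewrite fM mulmxA.
rewrite [X in v - X]NE opprB addrC subrK; apply: NP.
by exists (v *m pinvmx M); rewrite fM mulmxA.
Qed.

Lemma linear_injective_lower m n (f : {linear 'rV[R]_m -> 'rV[R]_n}) :
  injective f -> exists2 C, 0 < C & forall u, `|u| <= C * `|f u|.
Proof.
move=> fi; pose M := lin1_mx f.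
have fM u : f u = u *m M by rewrite mul_rV_lin1.
have rf : row_free M.
  by apply: inj_row_free => v; rewrite -fM => h; apply: fi; rewrite h linear0.
have [C C0 hC] := linear_lipschitz (@linear_continuous_rV n _ (mulmxr (pinvmx M))).
by exists C => // u; have := hC (f u); rewrite /= fM -mulmxA mulmxVp // mulmx1.
Qed.

(** Cauchy-Schwarz against the constant 1, by summing 2ab <= a^2 + b^2 over all pairs. *)
Lemma sum_sqr_le (I : finType) (a : I -> R) :
  (\sum_i a i) ^+ 2 <= #|I|%:R * \sum_i a i ^+ 2.
Proof.
have e1 : \sum_i \sum_(j : I) a i ^+ 2 = #|I|%:R * \sum_i a i ^+ 2.
  by rewrite mulr_sumr; apply: eq_bigr => i _; rewrite sumr_const mulr_natl.
have e2 : \sum_(i : I) \sum_j a j ^+ 2 = #|I|%:R * \sum_i a i ^+ 2.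
  by rewrite sumr_const mulr_natl.
have -> : #|I|%:R * \sum_i a i ^+ 2 = \sum_i \sum_j (a i ^+ 2 + a j ^+ 2) / 2.
  under [RHS]eq_bigr => i _ do rewrite -mulr_suml big_split /=.
  by rewrite -mulr_suml big_split /= e1 e2; lra.
rewrite expr2 mulr_suml.
apply: ler_sum => i _; rewrite mulr_sumr; apply: ler_sum => j _.
have : 0 <= (a i - a j) ^+ 2 by exact: sqr_ge0.
by rewrite !expr2 => h; lra.
Qed.

Lemma der_sum (I : Type) (r : seq I) (f df : I -> R -> R) (t : R) :
  (forall i, is_derive t 1 (f i) (df i t)) ->
  is_derive t 1 (fun s => \sum_(i <- r) f i s) (\sum_(i <- r) df i t).
Proof.
move=> h; elim: r => [|i r IH].
  rewrite big_nil (_ : (fun _ => _) = cst 0); first exact: is_derive_cst.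
  by apply/funext => s; rewrite big_nil.
rewrite big_cons (_ : (fun _ => _) = fun s => f i s + \sum_(j <- r) f j s).
  exact: der_add.
by apply/funext => s; rewrite big_cons.
Qed.

(** The sum of squares [E] satisfies E' <= C E, so E e^(-Ct) cannot exceed its initial value 0. *)
Lemma gronwall_zero (I : finType) (g dg : I -> R -> R) (K : R) :
  (forall i (t : R), 0 <= t <= 1 -> is_derive t 1 (g i) (dg i t)) ->
  (forall i (t : R), 0 <= t <= 1 -> `|dg i t| <= K * \sum_j `|g j t|) ->
  (forall i, g i 0 = 0) -> forall i, g i 1 = 0.
Proof.
move=> gd gb g0 i.
pose E t := \sum_i g i t * g i t.
pose dE t := \sum_i (dg i t * g i t + g i t * dg i t).
(* The factor 2 comes from differentiating squares, the cardinality from [sum_sqr_le]. *)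
pose C := 2 * K * #|I|%:R.
have Ed (t : R) : 0 <= t <= 1 -> is_derive t 1 E (dE t).
  move=> ht.
  apply: (@der_sum I (index_enum I) (fun i t => g i t * g i t)
    (fun i t => dg i t * g i t + g i t * dg i t)) => j.
  by apply: der_mul; exact: gd.
have Eb t : 0 <= t <= 1 -> dE t <= C * E t.
  move=> ht.
  have K0 : 0 <= K * \sum_j `|g j t| by apply: le_trans (gb i t ht).
  have h1 : dE t <= \sum_j 2 * (K * \sum_j `|g j t|) * `|g j t|.
    apply: ler_sum => j _; apply: (le_trans (ler_norm _)).
    have -> : dg j t * g j t + g j t * dg j t = 2 * (dg j t * g j t) by ring.
    rewrite !normrM (ger0_norm (x := 2)) // -mulrA ler_wpM2l //.
    by rewrite ler_wpM2r // gb.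
  apply: (le_trans h1); rewrite -mulr_sumr -2!mulrA -expr2.
  have h2 := sum_sqr_le (fun j => `|g j t|).
  have e : \sum_j `|g j t| ^+ 2 = E t.
    by apply: eq_bigr => j _; rewrite real_normK ?num_real // expr2.
  rewrite e in h2.
  have [K1|K1] := leP 0 K.
    by rewrite /C -!mulrA; do 2 rewrite ler_wpM2l //.
  (* A negative [K] is not excluded, but then the bound itself forces every [g j t] to vanish. *)
  have s0 : \sum_j `|g j t| = 0.
    apply/eqP; rewrite eq_le sumr_ge0 // andbT.
    by have := K0; rewrite nmulr_rge0.
  have E0 : E t = 0.
    rewrite /E big1 // => j _; have := psumr_eq0P (fun j _ => normr_ge0 (g j t)) s0.
    by move=> /(_ j isT) /eqP; rewrite normr_eq0 => /eqP ->; rewrite mulr0.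
  by rewrite s0 E0 expr2 !mulr0.
pose F t := E t * expR (- C * t).
have Fd (t : R) : 0 <= t <= 1 -> is_derive t 1 F ((dE t - C * E t) * expR (- C * t)).
  move=> ht; have h := der_mul (Ed t ht) (der_exp (- C) t).
  by apply: (is_derive_eq h); ring.
have [c] : exists2 c, c \in `[0, 1]%R & F 1 - F 0 = (dE c - C * E c) * expR (- C *
  c) * (1 - 0).
  by apply: (MVT_closed ltr01) => t; rewrite in_itv /=; exact: Fd.
rewrite in_itv /= subr0 mulr1 => hc eF.
have F0 : F 0 = 0.
  by rewrite /F /E big1 ?mul0r // => j _; rewrite g0 mulr0.
have F1 : F 1 <= 0.
  rewrite -[F 1]subr0 -[X in _ - X]F0 eF mulr_le0_ge0 ?expR_ge0 //.
  by rewrite subr_le0 Eb.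
have E1 : E 1 <= 0 by move: F1; rewrite /F pmulr_lle0 // expR_gt0.
have E0 : E 1 = 0.
  apply/eqP; rewrite eq_le E1 /= sumr_ge0 // => j _; rewrite -expr2; exact: sqr_ge0.
have h j : 0 <= g j 1 * g j 1 by rewrite -expr2 sqr_ge0.
have := psumr_eq0P (fun j _ => h j) E0 => /(_ i isT) /eqP.
by rewrite mulf_eq0 orbb => /eqP.
Qed.

End LinearBounds.

(** * Local domination and closeness near a point *)

Section NearBounds.
Context {R : realType}.

Lemma near_normP (V : normedModType R) (P : V -> Prop) (x : V) :
  (\forall y \near x, P y) <-> exists2 r : R, 0 < r & forall y, `|x - y| < r -> P y.
Proof.
split; first by move=> /nbhs_normP [r r0 h]; exists r => // y hy; exact: h.
by move=> [r r0 h]; apply/nbhs_normP; exists r => // y hy; exact: h.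
Qed.

Lemma near_forall (V : normedModType R) (I : finType) (P : I -> V -> Prop) (x : V) :
  (forall i, \forall y \near x, P i y) -> \forall y \near x, forall i, P i y.
Proof. by move=> h; exact: filter_forall. Qed.

Lemma continuous_sub_linear (V W : normedModType R) (N : {linear W -> W})
    (p : V -> W) (x : V) : continuous N -> {for x, continuous p} ->
  {for x, continuous (fun y => p y - N (p y))}.
Proof.
move=> cN cp; apply: cvgB; first exact: cp.
by apply: (continuous_comp cp); exact: cN.
Qed.

Lemma near_bounded (V W : normedModType R) (f : V -> W) (x : V) :
  {for x, continuous f} -> exists C, \forall y \near x, `|f y| <= C.
Proof.
move=> cf; exists (`|f x| + 1).
have : \forall y \near x, `|f x - f y| < 1 by move: cf => /cvgrPdist_lt; apply.
apply: filterS => y h; rewrite -[f y](subrK (f x)).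
rewrite (le_trans (ler_normD _ _)) // addrC lerD2l distrC; exact: ltW.
Qed.

Lemma near_sum_dist (V W : normedModType R) (I : finType) (f : I -> V -> W) (x : V)
  (e : R) :
  (forall i, {for x, continuous (f i)}) -> 0 < e ->
  \forall y \near x, \sum_i `|f i x - f i y| < e.
Proof.
move=> cf; elim: (index_enum I) e => [|i r IH] e e0.
  by apply: nearW => y; rewrite big_nil.
have e2 : 0 < e / 2 by rewrite divr_gt0.
have h1 : \forall y \near x, `|f i x - f i y| < e / 2.
  by move: (cf i) => /cvgrPdist_lt; apply.
apply: filterS2 h1 (IH _ e2) => y a1 a2.
by rewrite big_cons (splitr e) ltrD.
Qed.

(** Since everything vanishes at [x], the difference quotients of [F] are dominated by those of the
    [h i], which tend to 0. *)
Lemma diff_dominated (V W : normedModType R) (I : finType) (F : V -> R)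
    (h : I -> V -> W) (x w : V) (C : R) :
  differentiable F x -> (forall i, differentiable (h i) x) ->
  F x = 0 -> (forall i, h i x = 0) -> (forall i, 'd (h i) x w = 0) ->
  (\forall y \near x, `|F y| <= C * \sum_i `|h i y|) -> 'd F x w = 0.
Proof.
move=> dF dh F0 h0 dh0 hb.
pose q (Z : normedModType R) (f : V -> Z) (t : R) : Z :=
  t^-1 *: (f (t *: w + x) - f x).
have qF : q _ F t @[t --> 0^'] --> 'd F x w.
  have h1 : derivable F x w by exact: diff_derivable.
  by rewrite -(deriveE _ dF); exact: h1.
have qh i : q _ (h i) t @[t --> 0^'] --> (0 : W).
  have h1 : derivable (h i) x w by exact: diff_derivable.
  by rewrite -(dh0 i) -(deriveE _ (dh i)); exact: h1.
have qs : C * \sum_i `|q _ (h i) t| @[t --> 0^'] --> C * 0.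
  apply: cvgM; first exact: cvg_cst.
  elim: (index_enum I) => [|i r IH].
    by under eq_fun do rewrite big_nil; exact: cvg_cst.
  have -> : (fun t => \sum_(j <- i :: r) `|q _ (h j) t|) =
      (fun t => `|q _ (h i) t| + \sum_(j <- r) `|q _ (h j) t|).
    by apply/funext => t; rewrite big_cons.
  have hi : `|q _ (h i) t| @[t --> 0^'] --> (0 : R).
    by apply/norm_cvg0P; exact: (qh i).
  have h1 := cvgD hi IH; rewrite addr0 in h1; exact: h1.
have cx : t *: w + x @[t --> (0 : R)] --> x.
  rewrite -[X in _ --> X]add0r; apply: cvgD; last exact: cvg_cst.
  by rewrite -[X in _ --> X](scale0r w); exact: scalel_continuous.
have hb' : \forall t \near (0 : R)^', `|q _ F t| <= C * \sum_i `|q _ (h i) t|.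
  have hb0 : \forall t \near (0 : R), `|F (t *: w + x)| <= C * \sum_i `|h i (t *: w
    + x)|.
    exact: (cx _ hb).
  have : \forall t \near (0 : R)^', `|F (t *: w + x)| <= C * \sum_i `|h i (t *: w + x)|.
    by rewrite near_withinE; apply: filterS hb0 => t ht _.
  apply: filterS => t ht; rewrite /q F0 subr0 normrZ.
  under eq_bigr do rewrite h0 subr0 normrZ.
  by rewrite -mulr_sumr mulrCA ler_wpM2l.
have nF : `|q _ F t| @[t --> 0^'] --> (0 : R).
  apply: (@squeeze_cvgr _ _ _ _ (fun=> 0) (fun t => C * \sum_i `|q _ (h i) t|)).
  - by apply: filterS hb' => t ->; rewrite normr_ge0.
  - exact: cvg_cst.
  - by rewrite mulr0 in qs.
have e : `|'d F x w| = 0 by apply: cvg_unique (cvg_norm qF) nF.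
by apply/eqP; rewrite -normr_eq0; apply/eqP.
Qed.

Section NearClose.
Context {V : normedModType R}.
Variables (x : V) (delta : V -> R).
Hypothesis delta0 : forall y, 0 <= delta y.
Implicit Types (f g : V -> R).

(** Equality up to O(delta) of locally bounded functions; boundedness is included so that products
    preserve the relation. *)
Definition near_close f g := exists C, \forall y \near x,
  [/\ `|f y| <= C, `|g y| <= C & `|f y - g y| <= C * delta y].

Lemma near_closeD f f' g g' : near_close f f' -> near_close g g' ->
  near_close (fun y => f y + g y) (fun y => f' y + g' y).
Proof.
move=> [C hC] [D hD]; exists (C + D).
apply: filterS2 hC hD => y [a1 a2 a3] [b1 b2 b3]; split.
- by rewrite (le_trans (ler_normD _ _)) // lerD.
- by rewrite (le_trans (ler_normD _ _)) // lerD.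
- have -> : f y + g y - (f' y + g' y) = (f y - f' y) + (g y - g' y) by ring.
  by rewrite mulrDl (le_trans (ler_normD _ _)) // lerD.
Qed.

Lemma near_closeN f f' : near_close f f' -> near_close (fun y => - f y) (fun y => -
  f' y).
Proof.
move=> [C hC]; exists C; apply: filterS hC => y [a1 a2 a3].
by rewrite -opprD !normrN.
Qed.

Lemma near_closeM f f' g g' : near_close f f' -> near_close g g' ->
  near_close (fun y => f y * g y) (fun y => f' y * g' y).
Proof.
move=> [C hC] [D hD]; exists (C * D + C * D).
apply: filterS2 hC hD => y [a1 a2 a3] [b1 b2 b3].
have C0 : 0 <= C by exact: le_trans a1.
have D0 : 0 <= D by exact: le_trans b1.
split.
- by rewrite normrM (le_trans (ler_pM _ _ a1 b1)) // lerDl mulr_ge0.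
- by rewrite normrM (le_trans (ler_pM _ _ a2 b2)) // lerDl mulr_ge0.
- have -> : f y * g y - f' y * g' y = f y * (g y - g' y) + (f y - f' y) * g' y by ring.
  rewrite [leRHS]mulrDl (le_trans (ler_normD _ _)) // lerD // normrM.
    by rewrite -mulrA ler_pM.
  by rewrite mulrAC ler_pM.
Qed.

Lemma near_closeV f f' : (forall y, 1 <= f y) -> (forall y, 1 <= f' y) ->
  near_close f f' -> near_close (fun y => (f y)^-1) (fun y => (f' y)^-1).
Proof.
move=> f1 f1' [C hC]; exists (C + 1); apply: filterS hC => y [a1 a2 a3].
have C0 : 0 <= C by exact: le_trans a1.
have h0 : 0 < f y by exact: lt_le_trans (f1 y).
have h0' : 0 < f' y by exact: lt_le_trans (f1' y).
have i1 : `|(f y)^-1| <= 1.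
  by rewrite ger0_norm ?invr_ge0 ?(ltW h0) //; have := f1 y; rewrite -invf_le1.
have i2 : `|(f' y)^-1| <= 1.
  by rewrite ger0_norm ?invr_ge0 ?(ltW h0') //; have := f1' y; rewrite -invf_le1.
split.
- by rewrite (le_trans i1) // lerDr.
- by rewrite (le_trans i2) // lerDr.
- have -> : (f y)^-1 - (f' y)^-1 = (f y)^-1 * (f' y)^-1 * (f' y - f y).
    by field; rewrite !gt_eqF.
  rewrite normrM distrC (le_trans (ler_piMl _ _)) //.
    by rewrite normrM mulr_ile1.
  by rewrite (le_trans a3) // ler_wpM2r // lerDl.
Qed.

Lemma near_close_cst (a : R) : near_close (fun=> a) (fun=> a).
Proof.
exists `|a|; apply: nearW => y; rewrite subrr normr0; split => //.
exact: mulr_ge0.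
Qed.

Lemma near_close_coord n (p p' : V -> 'rV[R]_n) (i : 'I_n) :
  {for x, continuous p} -> {for x, continuous p'} ->
  (forall y, `|p y - p' y| <= delta y) ->
  near_close (fun y => p y 0 i) (fun y => p' y 0 i).
Proof.
move=> cp cp' h; have [C hC] := near_bounded cp; have [D hD] := near_bounded cp'.
exists (C + D + 1); apply: filterS2 hC hD => y hy hy'.
have C0 : 0 <= C by exact: le_trans hy.
have D0 : 0 <= D by exact: le_trans hy'.
split.
- by rewrite (le_trans (coord_le_norm _ _)) // (le_trans hy) // -addrA lerDl addr_ge0.
- by rewrite (le_trans (coord_le_norm _ _)) // (le_trans hy') // addrAC lerDr addr_ge0.
- have := coord_le_norm (p y - p' y) i; rewrite !mxE => /le_trans -> //.
  by rewrite (le_trans (h y)) // ler_peMl // lerDr addr_ge0.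
Qed.

(** The entries are polynomials in the coordinates divided by 1 + |p|^2, which is at least 1, so the
    closure properties of [near_close] suffice. *)
Lemma near_close_cigar_acc n (p q r p' q' r' : V -> 'Cx[R]_n) (i : 'I_(n + n)) :
  (forall j, near_close (fun y => p y 0 j) (fun y => p' y 0 j)) ->
  (forall j, near_close (fun y => q y 0 j) (fun y => q' y 0 j)) ->
  (forall j, near_close (fun y => r y 0 j) (fun y => r' y 0 j)) ->
  near_close (fun y => cigar_acc (p y) (q y) (r y) 0 i)
             (fun y => cigar_acc (p' y) (q' y) (r' y) 0 i).
Proof.
move=> hp hq hr.
have hs j : near_close (fun y => (1 + sqrmod (p y) j)^-1) (fun y => (1 + sqrmod (p'
  y) j)^-1).
  apply: near_closeV => [y|y|]; try by rewrite lerDl sqrmod_ge0.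
  rewrite /sqrmod; apply: near_closeD; first exact: near_close_cst.
  by apply: near_closeD; under eq_fun do rewrite expr2;
    under [X in near_close _ X]eq_fun do rewrite expr2;
    apply: near_closeM; [exact: hp|exact: hp|exact: hp|exact: hp].
rewrite -(splitK i); case: (fintype.split i) => j /=.
  rewrite -[X in near_close X _]/(fun y => re (cigar_acc (p y) (q y) (r y)) j).
  rewrite -[X in near_close _ X]/(fun y => re (cigar_acc (p' y) (q' y) (r' y)) j).
  under eq_fun do rewrite !cxE; under [X in near_close _ X]eq_fun do rewrite !cxE.
  apply: near_closeM => //.
  apply: near_closeD; [|apply: near_closeN]; apply: near_closeM; try apply: near_closeN;
    try exact: hp; (apply: near_closeD; [|try apply: near_closeN]; apply: near_closeM;
    [exact: hq|exact: hr|exact: hq|exact: hr]).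
rewrite -[X in near_close X _]/(fun y => im (cigar_acc (p y) (q y) (r y)) j).
rewrite -[X in near_close _ X]/(fun y => im (cigar_acc (p' y) (q' y) (r' y)) j).
under eq_fun do rewrite !cxE; under [X in near_close _ X]eq_fun do rewrite !cxE.
apply: near_closeM => //.
apply: near_closeD; apply: near_closeM; try apply: near_closeN;
  try exact: hp; (apply: near_closeD; [|try apply: near_closeN]; apply: near_closeM;
  [exact: hq|exact: hr|exact: hq|exact: hr]).
Qed.

End NearClose.
End NearBounds.

(** * Holomorphic charts with vanishing second fundamental form *)

(** The perturbation term is at most half of [nu] and is absorbed into the left side, which doubles
    the constant. *)
Lemma absorb (R : realType) (C nu nx ny s : R) : 0 < C -> 0 <= nu ->
  s < (2 * C)^-1 -> nu <= C * nx -> nx <= ny + nu * s -> nu <= 2 * C * ny.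
Proof.
move=> C0 nu0 se h1 h2.
have h3 : C * (nu * s) <= nu / 2.
  have -> : nu / 2 = C * (nu * (2 * C)^-1) by field; rewrite gt_eqF.
  by rewrite ler_pM2l // ler_wpM2l // ltW.
have h5 : C * nx <= C * ny + C * (nu * s) by rewrite -mulrDr ler_pM2l.
by rewrite -mulrA; lra.
Qed.

Section CigarAccSmooth.
Context {R : realType} {V : normedModType R} {n : nat}.
Variables (U : set V).
Hypothesis oU : open U.
Implicit Types (p q r : V -> 'Cx[R]_n).

Lemma Cr_cigar_coef m p q r j : Cr m U p -> Cr m U q -> Cr m U r ->
  Cr m U (fun y => (1 + sqrmod (p y) j)^-1 * re (cmul (q y) (r y)) j) /\
  Cr m U (fun y => (1 + sqrmod (p y) j)^-1 * im (cmul (q y) (r y)) j).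
Proof.
move=> Cp Cq Cr'.
have Cs : Cr m U (fun y => (1 + sqrmod (p y) j)^-1).
  apply: (Cr_comp1 (U' := [set s : R | s != 0]) (g := @GRing.inv R) (f := fun y =>
    1 + sqrmod (p y) j)) (Cr_inv m) => //.
    by move=> y _; exact: sqrmod1_neq0.
  by apply: Cr_add => //; [exact: Cr_cst|exact: Cr_sqrmod].
have Crq := Cr_re j oU Cq; have Ciq := Cr_im j oU Cq.
have Crr := Cr_re j oU Cr'; have Cir := Cr_im j oU Cr'.
split; apply: Cr_mul => //.
  apply: (@Cr_ext _ _ _ _ _ (fun y => re (q y) j * re (r y) j + (-1 * im (q y) j) *
    im (r y) j)) => //.
    by move=> y _; rewrite !cxE; ring.
  by apply: Cr_add => //; apply: Cr_mul => //; apply: Cr_mul => //; exact: Cr_cst.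
apply: (@Cr_ext _ _ _ _ _ (fun y => re (q y) j * im (r y) j + im (q y) j * re (r y)
  j)) => //.
  by move=> y _; rewrite !cxE.
by apply: Cr_add => //; exact: Cr_mul.
Qed.

(** Grouped so that every term carries a coordinate of [p] as last factor: where [p] vanishes, the
    derivatives of the coefficients drop out. *)
Lemma re_cigar_acc (p q r : 'Cx[R]_n) j : re (cigar_acc p q r) j =
  ((1 + sqrmod p j)^-1 * re (cmul q r) j) * re p j +
  ((1 + sqrmod p j)^-1 * im (cmul q r) j) * im p j.
Proof. by rewrite !cxE; ring. Qed.

Lemma im_cigar_acc (p q r : 'Cx[R]_n) j : im (cigar_acc p q r) j =
  ((1 + sqrmod p j)^-1 * im (cmul q r) j) * re p j +
  (-1 * ((1 + sqrmod p j)^-1 * re (cmul q r) j)) * im p j.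
Proof. by rewrite !cxE; ring. Qed.

Lemma Cr_cigar_acc m p q r :
  Cr m U p -> Cr m U q -> Cr m U r -> Cr m U (fun y => cigar_acc (p y) (q y) (r y)).
Proof.
move=> Cp Cq Cr'; apply: Cr_cx => // j; have [C1 C2] := Cr_cigar_coef j Cp Cq Cr'.
  apply: (Cr_ext oU (fun y _ => esym (re_cigar_acc (p y) (q y) (r y) j))).
  by apply: Cr_add => //; apply: Cr_mul => //; [exact: Cr_re|exact: Cr_im].
apply: (Cr_ext oU (fun y _ => esym (im_cigar_acc (p y) (q y) (r y) j))).
apply: Cr_add => //; apply: Cr_mul => //; [exact: Cr_re| |exact: Cr_im].
by apply: Cr_mul => //; exact: Cr_cst.
Qed.

Lemma diff_mul_zero (g h : V -> R) (x w : V) : differentiable g x ->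
  differentiable h x -> h x = 0 ->
  differentiable (fun y => g y * h y) x /\ 'd (fun y => g y * h y) x w = g x * 'd h x w.
Proof.
move=> dg dh h0; have [d e] := diff_scale dg dh; split=> //.
by apply: (etrans (e w)); rewrite h0 scaler0 addr0.
Qed.

Lemma diff_cigar_acc0 p q r x w : U x -> Cr 1 U p -> Cr 1 U q -> Cr 1 U r ->
  p x = 0 -> 'd (fun y => cigar_acc (p y) (q y) (r y)) x w =
    cmul (cconj ('d p x w)) (cmul (q x) (r x)).
Proof.
move=> Ux Cp Cq Cr' p0.
have df : differentiable (fun y => cigar_acc (p y) (q y) (r y)) x.
  by have [/(_ x Ux)] := Cr_cigar_acc Cp Cq Cr'.
have dp : differentiable p x by have [/(_ x Ux)] := Cp.
apply: cx_ext => j; have [[C1 _] [C2 _]] := Cr_cigar_coef j Cp Cq Cr'.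
have dr : differentiable (fun y => re (p y) j) x by have []
  := diff_coord (lshift n j) dp.
have di : differentiable (fun y => im (p y) j) x by have []
  := diff_coord (rshift n j) dp.
have r0 : re (p x) j = 0 by rewrite p0 cxE.
have i0 : im (p x) j = 0 by rewrite p0 cxE.
have dm := differentiable_cst (-1 : R) x.
have s0 : (1 + sqrmod (p x) j)^-1 = 1.
  by rewrite /sqrmod r0 i0 expr0n /= !addr0 invr1.
rewrite -(diff_re j w df) -(diff_im j w df); split.
  have -> : (fun y => re (cigar_acc (p y) (q y) (r y)) j) = (fun y =>
      ((1 + sqrmod (p y) j)^-1 * re (cmul (q y) (r y)) j) * re (p y) j +
      ((1 + sqrmod (p y) j)^-1 * im (cmul (q y) (r y)) j) * im (p y) j).
    by apply/funext => y; exact: re_cigar_acc.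
  have [d1 e1] := diff_mul_zero w (C1 x Ux) dr r0.
  have [d2 e2] := diff_mul_zero w (C2 x Ux) di i0.
  apply: (etrans (diff_addE w d1 d2)); rewrite e1 e2 s0 (diff_re j w dp) (diff_im j
    w dp).
  by rewrite [in RHS]re_cmul re_cconj im_cconj; ring.
have -> : (fun y => im (cigar_acc (p y) (q y) (r y)) j) = (fun y =>
    ((1 + sqrmod (p y) j)^-1 * im (cmul (q y) (r y)) j) * re (p y) j +
    (-1 * ((1 + sqrmod (p y) j)^-1 * re (cmul (q y) (r y)) j)) * im (p y) j).
  by apply/funext => y; exact: im_cigar_acc.
have [d1 e1] := diff_mul_zero w (C2 x Ux) dr r0.
have [d3 _] := diff_scale dm (C1 x Ux).
have [d2 e2] := diff_mul_zero w d3 di i0.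
apply: (etrans (diff_addE w d1 d2)); rewrite e1 [X in _ + X]e2 s0 (diff_re j w dp)
  (diff_im j w dp).
by rewrite [in RHS]im_cmul re_cconj im_cconj /cst /GRing.scale /=; ring.
Qed.

End CigarAccSmooth.

Section Chart.
Context {R : realType} {k n : nat}.
Variables (U : set 'Cx[R]_k) (phi : 'Cx[R]_k -> 'Cx[R]_n).
Hypothesis oU : open U.
Hypothesis sphi : smooth U phi.
Hypothesis phi_inj : forall x, U x -> injective ('d phi x).
Hypothesis phi_ff : forall x u v, U x -> exists a,
  D2 phi x u v - cigar_acc (phi x) ('d phi x u) ('d phi x v) = 'd phi x a.

Let b (i : 'I_(k + k)) : 'Cx[R]_k := delta_mx 0 i.

Let Cd m u : Cr m U (fun y => 'd phi y u).
Proof. by have [_ h] := sphi m.+1; exact: h. Qed.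

Let Cdd m u v : Cr m U (fun y => D2 phi y u v).
Proof. by have [_ h] := Cd m.+1 u; exact: h. Qed.

Let nU x : U x -> \forall y \near x, U y.
Proof. by move=> Ux; exact: open_nbhs_nbhs. Qed.

(** Injectivity of ['d phi x] gives the bound at [x]; nearby differentials are small perturbations,
    handled by [absorb]. *)
Lemma near_lower_bound x : U x ->
  exists C, \forall y \near x, forall u, `|u| <= C * `|'d phi y u|.
Proof.
move=> Ux; have [C C0 hC] := linear_injective_lower (phi_inj Ux).
exists (2 * C); pose e := (2 * C)^-1.
have e0 : 0 < e by rewrite invr_gt0 mulr_gt0.
pose s y := \sum_i `|'d phi x (b i) - 'd phi y (b i)|.
have cb i : {for x, continuous (fun y => 'd phi y (b i))}.
  by have := Cd 0 (b i); apply.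
apply: filterS (near_sum_dist cb e0) => y se u.
have h1 : `|'d phi x u - 'd phi y u| <= `|u| * s y := linear_dist_le _ _ u.
have h2 : `|'d phi x u| <= `|'d phi y u| + `|u| * s y.
  rewrite -[X in `|X| <= _](subrK ('d phi y u)) (le_trans (ler_normD _ _)) //.
  by rewrite addrC lerD2l.
exact: (absorb C0 (normr_ge0 u) se (hC u) h2).
Qed.

Section Defect.
Variable N : {linear 'Cx[R]_n -> 'Cx[R]_n}.

Let Nc : continuous N.
Proof. exact: linear_continuous_rV. Qed.

Let defect y : R := \sum_i `|N ('d phi y (b i))|.

(** The second fundamental form equals ['d phi y a]. By [near_lower_bound] the vector [a] stays
    bounded near [x], so applying [N] costs at most a constant times [N] of the basis tangent
    vectors. *)
Lemma near_second_defect x u v : U x -> exists C, \forall y \near x,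
  `|N (D2 phi y u v) - N (cigar_acc (phi y) ('d phi y u) ('d phi y v))| <= C * defect y.
Proof.
move=> Ux; have [C hC] := near_lower_bound Ux.
pose F y := D2 phi y u v - cigar_acc (phi y) ('d phi y u) ('d phi y v).
have cF : {for x, continuous F}.
  have c1 : {for x, continuous (fun y => D2 phi y u v)} by have := Cdd 0 u v; apply.
  have c2 : {for x, continuous (fun y => cigar_acc (phi y) ('d phi y u) ('d phi y v))}.
    by have := Cr_cigar_acc oU (sphi 0) (Cd 0 u) (Cd 0 v); apply.
  exact: (cvgB c1 c2).
have [D hD] := near_bounded cF.
exists (`|C| * D); apply: filterS3 (nU Ux) hC hD => y Uy h1 h2.
have [a ea] := phi_ff u v Uy.
have -> : N (D2 phi y u v) - N (cigar_acc (phi y) ('d phi y u) ('d phi y v)) = N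
  ('d phi y a).
  by rewrite -ea; exact: esym (linearB N _ _).
apply: (le_trans (linear_norm_le _ N a)); apply: ler_wpM2r; first exact: sumr_ge0.
have h3 := h1 a; rewrite -ea -/(F y) in h3.
apply: (le_trans h3); apply: (@le_trans _ _ (`|C| * `|F y|)).
  by apply: ler_wpM2r => //; exact: ler_norm.
by apply: ler_wpM2l.
Qed.

Variable T : set 'Cx[R]_n.
Hypothesis T_complex : complex_linear_subspace T.
Hypothesis T_triple : forall u w, T u -> T w -> T (cmul (cconj w) (cmul u u)).
Hypothesis NT : forall v, N v = 0 <-> T v.
Hypothesis NN : forall v, N (v - N v) = 0.

(** This measures how far the point [phi y] and its tangent space are from lying in [T]. *)
Let delta y : R := `|N (phi y)| + \sum_i `|N ('d phi y (b i))|.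

Let delta0 y : 0 <= delta y.
Proof. by rewrite addr_ge0 // sumr_ge0. Qed.

Let proj_close x (p : 'Cx[R]_k -> 'Cx[R]_n) i : {for x, continuous p} ->
  (forall y, `|N (p y)| <= delta y) ->
  near_close x delta (fun y => p y 0 i) (fun y => (p y - N (p y)) 0 i).
Proof.
move=> cp hp; apply: near_close_coord; [exact: delta0|exact: cp| |].
  exact: (continuous_sub_linear Nc cp).
by move=> y; rewrite opprB addrC subrK.
Qed.

(** Replace the three arguments by their components [v - N v] in [T]: the acceleration then lies in
    [T] and is killed by [N], and the replacement changes it by O(delta). *)
Lemma near_acc_defect x i l : U x -> exists C, \forall y \near x,
  `|N (cigar_acc (phi y) ('d phi y (b i)) ('d phi y (b l)))| <= C * delta y.
Proof.
move=> Ux.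
have cb j : {for x, continuous (fun y => 'd phi y (b j))} by have := Cd 0 (b j); apply.
have cphi : {for x, continuous phi} by have := sphi 0; apply.
have hphi y : `|N (phi y)| <= delta y by rewrite lerDl sumr_ge0.
have hb j y : `|N ('d phi y (b j))| <= delta y.
  by rewrite /delta (bigD1 j) //= addrCA lerDl addr_ge0 // sumr_ge0.
pose acc y := cigar_acc (phi y) ('d phi y (b i)) ('d phi y (b l)).
pose acc' y := cigar_acc (phi y - N (phi y)) ('d phi y (b i) - N ('d phi y (b i)))
  ('d phi y (b l) - N ('d phi y (b l))).
have Nacc' y : N (acc' y) = 0.
  by apply/NT; apply: (csub_cigar_acc T_complex T_triple); apply/NT; exact: NN.
have hc j : near_close x delta (fun y => acc y 0 j) (fun y => acc' y 0 j).
  apply: near_close_cigar_acc => // j'; apply: proj_close => //; exact: hb.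
have [C hC] := choice hc.
have [K K0 hK] := linear_lipschitz Nc.
exists (K * \sum_j C j).
have : \forall y \near x, forall j, `|acc y 0 j - acc' y 0 j| <= C j * delta y.
  by apply: near_forall => j; apply: filterS (hC j) => y [].
apply: filterS => y hy.
have e : N (acc y - acc' y) = N (acc y).
  exact: (etrans (linearB N _ _) (etrans (congr1 (fun z => N (acc y) - z) (Nacc'
    y)) (subr0 _))).
rewrite -[leLHS]/(`|N (acc y)|) -e.
apply: (le_trans (hK _)); rewrite -mulrA; apply: ler_wpM2l; first exact: ltW.
apply: (le_trans (norm_le_sum _)); rewrite mulr_suml; apply: ler_sum => j _.
by move: (hy j); move: (acc y) (acc' y) => z1 z2; rewrite !mxE.
Qed.

Lemma near_D2_defect x : U x -> exists2 C, 0 <= C & \forall y \near x,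
  forall i l, `|N (D2 phi y (b i) (b l))| <= C * delta y.
Proof.
move=> Ux.
have h (il : 'I_(k + k) * 'I_(k + k)) : exists C, \forall y \near x,
    `|N (D2 phi y (b il.1) (b il.2))| <= C * delta y.
  have [C hC] := near_acc_defect il.1 il.2 Ux.
  have [D hD] := near_second_defect (b il.1) (b il.2) Ux.
  exists (`|D| + C); apply: filterS2 hC hD => y.
  move: (N (D2 _ _ _ _)) (N (cigar_acc _ _ _)) => z1 z2 h1 h2.
  rewrite -(subrK z2 z1) (le_trans (ler_normD _ _)) // mulrDl lerD //.
  apply: (le_trans h2); apply: (@le_trans _ _ (`|D| * \sum_i `|N ('d phi y (b i))|)).
    by apply: ler_wpM2r; [exact: sumr_ge0|exact: ler_norm].
  by apply: ler_wpM2l => //; rewrite /delta lerDr.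
have [C hC] := choice h.
exists (\sum_il `|C il|); first exact: sumr_ge0.
have : \forall y \near x, forall il, `|N (D2 phi y (b il.1) (b il.2))| <= C il *
  delta y.
  exact: near_forall.
apply: filterS => y hy i l; apply: (le_trans (hy (i, l))); apply: ler_wpM2r => //.
apply: (le_trans (ler_norm _)); rewrite (bigD1 (i, l)) //= lerDl; exact: sumr_ge0.
Qed.

Let diff_N0 (f : 'Cx[R]_k -> 'Cx[R]_n) y w j : differentiable f y ->
  differentiable (fun z => N (f z) 0 j) y /\
  'd (fun z => N (f z) 0 j) y w = N ('d f y w) 0 j.
Proof.
move=> df; have [d1 e1] := diff_linE w Nc df; have [d2 e2] := diff_coord j d1.
split=> //; exact: (etrans (e2 w) (congr1 (fun z : 'Cx[R]_n => z 0 j) e1)).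
Qed.

(** Along the segment from [x] to [y], the coordinates of [N (phi)] and [N ('d phi)] satisfy a
    linear differential inequality: their derivatives are bounded by [delta], hence by the
    coordinates themselves. They vanish at [x], so Gronwall applies. *)
Lemma near_tangent x : U x -> T (phi x) -> (forall u, T ('d phi x u)) ->
  \forall y \near x, T (phi y) /\ forall u, T ('d phi y u).
Proof.
move=> Ux Tx Tdx; have [C C0 hC] := near_D2_defect Ux.
have nUx : \forall y \near x, U y by exact: open_nbhs_nbhs.
pose Q y := U y /\ forall i l, `|N (D2 phi y (b i) (b l))| <= C * delta y.
have hQ : \forall y \near x, Q y by apply: filterS2 nUx hC => y.
have [r r0 hr] := (near_normP Q x).1 hQ.
apply: ((near_normP (fun y => T (phi y) /\ forall u, T ('d phi y u)) x).2).
exists r; first exact: r0.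
move=> y xy.
pose w := y - x; pose yt (t : R) := x + t *: w.
have hyt t : 0 <= t <= 1 -> U (yt t) /\
    forall i l, `|N (D2 phi (yt t) (b i) (b l))| <= C * delta (yt t).
  move=> /andP[t0 t1]; apply: hr; rewrite /= /yt opprD addrA subrr add0r normrN normrZ.
  by rewrite (le_lt_trans _ xy) // ger0_norm // distrC ler_piMl.
pose g (s : 'I_(n + n) + 'I_(k + k) * 'I_(n + n)) (t : R) : R := match s with
  | inl j => N (phi (yt t)) 0 j
  | inr p => N ('d phi (yt t) (b p.1)) 0 p.2 end.
pose dg (s : 'I_(n + n) + 'I_(k + k) * 'I_(n + n)) (t : R) : R := match s with
  | inl j => N ('d phi (yt t) w) 0 j
  | inr p => N (D2 phi (yt t) (b p.1) w) 0 p.2 end.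
(* The 1 bounds the derivative of [N (phi)]; the other term arises when [w] is expanded in the
   [k + k] basis vectors inside [D2]. *)
pose K := `|w| * (1 + (k + k)%:R * C).
have gd s (t : R) : 0 <= t <= 1 -> is_derive t 1 (g s) (dg s t).
  move=> /hyt [Ut _]; case: s => [j|p] /=.
    have dphi : differentiable phi (yt t) by have [/(_ _ Ut)] := sphi 1.
    have [d1 <-] := diff_N0 w j dphi.
    exact: (@is_derive_line _ _ _ (fun z => N (phi z) 0 j)).
  have dphi : differentiable (fun z => 'd phi z (b p.1)) (yt t) by have [/(_ _ Ut)]
    := Cd 1 (b p.1).
  have [d1 e1] := diff_N0 w p.2 dphi.
  by apply: (is_derive_eq (@is_derive_line _ _ _ (fun z => N ('d phi z (b p.1)) 0
    p.2) x w t d1)).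
have hdelta t : delta (yt t) <= \sum_s `|g s t|.
  rewrite big_sumType /=; apply: lerD; first exact: norm_le_sum.
  rewrite -(pair_bigA _ (fun i j => `|N ('d phi (yt t) (b i)) 0 j|)) /=.
  by apply: ler_sum => i _; exact: norm_le_sum.
have gb s (t : R) : 0 <= t <= 1 -> `|dg s t| <= K * \sum_j `|g j t|.
  move=> ht; have [Ut hD] := hyt t ht.
  apply: (@le_trans _ _ (K * delta (yt t))); last first.
    by apply: ler_wpM2l; [rewrite mulr_ge0 // addr_ge0 // mulr_ge0|exact: hdelta].
  case: s => [j|p] /=; apply: (le_trans (coord_le_norm _ _)).
    apply: (le_trans (linear_norm_le ('d phi (yt t)) N w)).
    rewrite /K -mulrA; apply: ler_wpM2l => //.
    apply: (@le_trans _ _ (1 * delta (yt t))); first by rewrite mul1r /delta lerDr.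
    by apply: ler_wpM2r => //; rewrite lerDl mulr_ge0.
  apply: (le_trans (linear_norm_le ('d (fun z => 'd phi z (b p.1)) (yt t)) N w)).
  rewrite /K -mulrA; apply: ler_wpM2l => //.
  apply: (@le_trans _ _ (((k + k)%:R * C) * delta (yt t))); last first.
    by apply: ler_wpM2r => //; rewrite lerDr.
  apply: (@le_trans _ _ (\sum_(l < k + k) C * delta (yt t))).
    by apply: ler_sum => l _; exact: hD.
  by rewrite sumr_const card_ord -mulrA mulr_natl.
have g0 s : g s 0 = 0.
  have y0 : yt 0 = x by rewrite /yt scale0r addr0.
  case: s => [j|p] /=; rewrite y0.
    by have /NT -> := Tx; rewrite mxE.
  by have /NT -> := Tdx (b p.1); rewrite mxE.
have y1 : yt 1 = y by rewrite /yt scale1r /w addrC subrK.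
have g1 := gronwall_zero gd gb g0.
have Nb i : N ('d phi y (b i)) = 0.
  by apply/rowP => j; have := g1 (inr (i, j)); rewrite /= y1 mxE.
split; first by apply/NT/rowP => j; have := g1 (inl j); rewrite /= y1 mxE.
move=> u; apply/NT; apply/eqP; rewrite -normr_le0.
apply: (le_trans (linear_norm_le ('d phi y) N u)).
by rewrite big1 ?mulr0 // => i _; have := Nb i; rewrite /b => ->; rewrite normr0.
Qed.

End Defect.

(** * The tangent space at the origin and its triple product *)

Section Origin.
Hypothesis hphi : forall x u, U x -> 'd phi x (mulI u) = mulI ('d phi x u).
Variable x : 'Cx[R]_k.
Hypothesis Ux : U x.
Hypothesis phi0 : phi x = 0.

Let T : set 'Cx[R]_n := [set z | exists u, z = 'd phi x u].

Lemma tangent_complex : complex_linear_subspace T.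
Proof.
split; first by exists 0; rewrite linear0.
  by move=> _ _ [u ->] [v ->]; exists (u + v); rewrite linearD.
move=> a c _ [u ->]; exists (a *: u + c *: mulI u).
rewrite -(hphi u Ux).
apply: (etrans _ (esym (linearD ('d phi x) _ _))).
by apply: congr2; apply: esym; exact: linearZ.
Qed.

Let cigar_acc00 (q r : 'Cx[R]_n) : cigar_acc 0 q r = 0.
Proof. by apply: cx_ext => j; rewrite !cxE; split; ring. Qed.

Lemma tangent_D2 u v : T (D2 phi x u v).
Proof.
have [a ea] := phi_ff u v Ux; exists a; rewrite -ea phi0 cigar_acc00.
exact: esym (subr0 _).
Qed.

Let T_sub u v : T u -> T v -> T (u - v).
Proof. exact: (csubB tangent_complex). Qed.

(** Each coordinate of [N (D2 phi - cigar_acc)] is dominated by the functions [N ('d phi y (b i))].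
    These vanish at [x], and so do their derivatives, since [tangent_D2] puts second derivatives in
    [T]; [diff_dominated] then kills the derivative of the former. *)
Lemma tangent_D3 v w :
  T ('d (fun y => D2 phi y v v) x w - cmul (cconj ('d phi x w)) (cmul ('d phi x v)
    ('d phi x v))).
Proof.
have [N [NT _]] := linear_range_defect ('d phi x).
have Nc : continuous N by exact: linear_continuous_rV.
pose acc y := cigar_acc (phi y) ('d phi y v) ('d phi y v).
have eacc := diff_cigar_acc0 oU w Ux (sphi 1) (Cd 1 v) (Cd 1 v) phi0.
have dacc : differentiable acc x.
  by have [/(_ x Ux)] := Cr_cigar_acc oU (sphi 1) (Cd 1 v) (Cd 1 v).
have dD : differentiable (fun y => D2 phi y v v) x by have [/(_ x Ux)] := Cdd 1 v v.
apply/NT; apply: (etrans (linearB N _ _)); apply/rowP => i; rewrite [RHS]mxE.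
have [d1 e1] := diff_linE w Nc dD; have [d2 e2] := diff_linE w Nc dacc.
have [d3 e3] := diff_coord i d1; have [d4 e4] := diff_coord i d2.
pose F y := N (D2 phi y v v) 0 i + -1 * N (acc y) 0 i.
have dm := differentiable_cst (-1 : R) x.
have [d5 e5] := diff_scale dm d4.
have dF : differentiable F x by exact: differentiableD.
pose Y := cmul (cconj ('d phi x w)) (cmul ('d phi x v) ('d phi x v)).
have eA : 'd (fun y => N (D2 phi y v v) 0 i) x w =
    N ('d (fun y => D2 phi y v v) x w) 0 i.
  exact: (etrans (e3 w) (congr1 (fun z : 'Cx[R]_n => z 0 i) e1)).
have eB : 'd (fun y => N (acc y) 0 i) x w = N Y 0 i.
  exact: (etrans (e4 w) (congr1 (fun z : 'Cx[R]_n => z 0 i) (etrans e2 (congr1 N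
    eacc)))).
have eB' : 'd (fun y => -1 *: (N (acc y) 0 i : R)) x w = - N Y 0 i.
  apply: (etrans (e5 w)).
  apply: (etrans (congr2 +%R (congr1 ( *:%R (-1 : R)) eB)
    (congr1 ( *:%R^~ (N (acc x) 0 i : R)) (diff_cstE (-1 : R) x w)))).
  by rewrite scale0r addr0 /GRing.scale /= mulN1r.
have eF : 'd F x w = (N ('d (fun y => D2 phi y v v) x w) - N Y) 0 i.
  apply: (etrans (diff_addE w d3 d5)); apply: (etrans (congr2 +%R eA eB')).
  by move: (N ('d _ _ _)) (N Y) => z1 z2; rewrite !mxE.
rewrite -eF.
have dh i' : differentiable (fun y => 'd phi y (b i')) x by have [/(_ x Ux)]
  := Cd 1 (b i').
have [C hC] := near_second_defect N v v Ux.
apply: (@diff_dominated _ _ _ _ F (fun i' y => N ('d phi y (b i'))) x w C) => //.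
- by move=> i'; have [] := diff_linE w Nc (dh i').
- rewrite /F; have -> : N (D2 phi x v v) = 0 by apply/NT; exact: tangent_D2.
  by rewrite /acc phi0 cigar_acc00 linear0 !mxE mulr0 addr0.
- by move=> i'; apply/NT; exists (b i').
- move=> i'; have [_ ->] := diff_linE w Nc (dh i').
  by apply/NT; exact: tangent_D2.
- apply: filterS hC => y; apply: le_trans.
  have := coord_le_norm (N (D2 phi y v v) - N (acc y)) i.
  by rewrite !mxE /F mulN1r.
Qed.

(** In [tangent_D3] the third derivative is complex linear in [w] and the triple product antilinear,
    so comparing [w] with [mulI w] separates them. *)
Lemma tangent_triple p q : T p -> T q -> T (cmul (cconj q) (cmul p p)).
Proof.
move=> [v ->] [w ->].
have hD := holomorphic_diff v oU (holomorphic_diff v oU (conj sphi hphi)).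
have t1 := tangent_D3 v w; have t2 := tangent_D3 v (mulI w).
have [_ /(_ x w Ux) h2] := hD.
have fin X W P X' W' : X' = mulI X -> W' = mulI W ->
    T (X - cmul (cconj W) (cmul P P)) -> T (X' - cmul (cconj W') (cmul P P)) ->
    T (cmul (cconj W) (cmul P P)).
  move=> -> -> s1 s2; have s3 := csubI tangent_complex s1.
  have s4 := csubZ tangent_complex 2^-1 (csubI tangent_complex (T_sub s3 s2)).
  (* With Q the triple product, i(X - Q) - (iX + iQ) = -2iQ; multiplying by i/2 returns Q. *)
  have e : 2^-1 *: mulI (mulI (X - cmul (cconj W) (cmul P P)) -
      (mulI X - cmul (cconj (mulI W)) (cmul P P))) = cmul (cconj W) (cmul P P).
    by apply: cx_ext => j; rewrite !cxE; split; field.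
  by rewrite e in s4.
exact: (fin _ _ _ _ _ h2 (hphi w Ux) t1 t2).
Qed.

End Origin.

End Chart.

(** * Totally geodesic submanifolds through the origin *)

Lemma near_neq0 (R : realType) (V W : normedModType R) (f : V -> W) (x : V) :
  {for x, continuous f} -> f x <> 0 -> \forall y \near x, f y <> 0.
Proof.
move=> cf fx; have n0 : 0 < `|f x| by rewrite normr_gt0; apply/eqP.
have : \forall y \near x, `|f x - f y| < `|f x| by move: cf => /cvgrPdist_lt; apply.
by apply: filterS => y + e; rewrite e subr0 ltxx.
Qed.

Lemma continuous_linear_comp (R : realType) (V W : normedModType R) (f : V -> W)
    (N : {linear W -> W}) (x : V) : continuous N -> {for x, continuous f} ->
  {for x, continuous (fun y => N (f y))}.
Proof. by move=> cN cf; apply: (continuous_comp cf); exact: cN. Qed.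

Section TotallyGeodesicThroughOrigin.
Context {R : realType} {k n : nat}.
Variables (S : set 'Cx[R]_n) (A : set (param R k n)).
Hypothesis S_sub : complex_submanifold S A.
Hypothesis S_conn : submanifold_connected S A.
Hypothesis S_complete : submanifold_complete A cigar_metric.
Hypothesis S_tg : totally_geodesic A cigar_metric.
Variables (phi0 : param R k n) (x0 : 'Cx[R]_k).
Hypothesis Aphi0 : A phi0.
Hypothesis Ux0 : pdom phi0 x0.
Hypothesis phi0x0 : phi0 x0 = 0.

Let T : set 'Cx[R]_n := [set z | exists u, z = 'd phi0 x0 u].

Let T_complex : complex_linear_subspace T.
Proof.
have [hA _ _] := S_sub; have [_ [_ hphi] _ _ _] := hA _ Aphi0.
exact: (tangent_complex hphi Ux0).
Qed.

Let T_triple u w : T u -> T w -> T (cmul (cconj w) (cmul u u)).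
Proof.
have [hA _ _] := S_sub; have [oU [sphi hphi] _ inj _] := hA _ Aphi0.
exact: (tangent_triple oU sphi inj
  (fun x u v Ux => second_fundamental S_sub S_complete S_tg u v Aphi0 Ux)
  hphi Ux0 phi0x0).
Qed.

(** The tangent condition supplies the initial data for Gronwall, which the position alone would
    not. One chart is enough in the definition: [V_tangent] transfers the condition to every
    other. *)
Let V : set 'Cx[R]_n := [set p | [/\ S p, T p & exists phi x,
  [/\ A phi, pdom phi x, phi x = p & forall u, T ('d phi x u)]]].

Let V_tangent phi x : A phi -> pdom phi x -> V (phi x) -> forall u, T ('d phi x u).
Proof.
move=> Aphi Ux [_ _ [psi [y [Apsi Uy e hy]]]] u.
by have [w ->] := chart_transition S_sub Aphi Apsi Ux Uy (esym e) u.
Qed.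

Let V_intro phi x : A phi -> pdom phi x -> T (phi x) ->
  (forall u, T ('d phi x u)) -> V (phi x).
Proof.
move=> Aphi Ux Tx hx; have [hA _ _] := S_sub; have [_ _ _ _ sub] := hA _ Aphi.
split; [by apply: sub; exists x|exact: Tx|].
by exists phi, x; split; [exact: Aphi|exact: Ux|by []|exact: hx].
Qed.

Let V_open : submanifold_open A V.
Proof.
move=> phi Aphi; have [hA _ _] := S_sub; have [oU [sphi _] _ inj _] := hA _ Aphi.
have [N [NT NN]] := linear_range_defect ('d phi0 x0).
rewrite openE => x [Ux Vx].
have [_ Tx _] := Vx.
have h := near_tangent oU sphi inj
  (fun x u v Ux => second_fundamental S_sub S_complete S_tg u v Aphi Ux)
  T_complex T_triple NT NN Ux Tx (V_tangent Aphi Ux Vx).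
have nU : \forall y \near x, pdom phi y by exact: open_nbhs_nbhs.
apply: filterS2 nU h => y Uy [h1 h2]; split; first exact: Uy.
exact: V_intro.
Qed.

Let V_closed : submanifold_open A (S `\` V).
Proof.
move=> phi Aphi; have [hA _ _] := S_sub; have [oU [sphi _] _ inj sub] := hA _ Aphi.
have [N [NT NN]] := linear_range_defect ('d phi0 x0).
have Nc : continuous N by exact: linear_continuous_rV.
rewrite openE => x [Ux [Sx nVx]].
have nU : \forall y \near x, pdom phi y by exact: open_nbhs_nbhs.
have Sy y : pdom phi y -> S (phi y) by move=> Uy; apply: sub; exists y.
(* A point outside [V] fails either in position or in some tangent direction [u]; either failure is
   the non-vanishing of a continuous function and persists nearby. *)
have [Tx|nTx] := pselect (T (phi x)); last first.
  have c1 : {for x, continuous phi} by have := sphi 0; apply.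
  have c2 := continuous_linear_comp Nc c1.
  have h : N (phi x) <> 0 by move=> /NT.
  apply: filterS2 nU (near_neq0 c2 h) => y Uy hy; split; first exact: Uy.
  split; first exact: Sy.
  by move=> [_ Ty _]; apply: hy; apply/NT.
have /existsNP [u nTu] : ~ forall u, T ('d phi x u).
  by move=> hx; apply: nVx; exact: V_intro.
have c1 : {for x, continuous (fun y => 'd phi y u)}.
  by have [_ /(_ u)] := sphi 1; apply.
have c2 := continuous_linear_comp Nc c1.
have h : N ('d phi x u) <> 0 by move=> /NT.
apply: filterS2 nU (near_neq0 c2 h) => y Uy hy; split; first exact: Uy.
split; first exact: Sy.
by move=> Vy; apply: hy; apply/NT; exact: V_tangent.
Qed.

Lemma totally_geodesic_tangent : S = T.
Proof.
have SV : V = S.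
  have VS : V `<=` S by move=> p [].
  have [V0|//] := S_conn VS V_open V_closed.
  have : V (phi0 x0).
    apply: V_intro => //; first by rewrite phi0x0; exact: (csub0 T_complex).
    by move=> u; exists u.
  by rewrite V0.
apply/seteqP; split=> z; first by rewrite -SV => -[].
(* The initial velocity aimed at [z] is a multiplier built from [z] applied to [z], so it lies in
   [T] and is tangent to [S] at the origin. *)
move=> Tz; have [u eu] := multiplier_fun T_complex T_triple arclength Tz Tz.
have [gam [sg gg g0 g1]] := submanifold_geodesic_ambient S_complete S_tg u Aphi0 Ux0.
have <- : gam 1 = z.
  apply: (radial_geodesic gg); first by rewrite g0.
  by rewrite g1 -eu.
exact: (submanifold_geodesic_sub S_sub sg).
Qed.

Lemma Psi_totally_geodesic : complex_linear_subspace (Psi @` S).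
Proof.
by rewrite totally_geodesic_tangent (Psi_csub T_complex T_triple); exact: T_complex.
Qed.

End TotallyGeodesicThroughOrigin.

Theorem theorem2 (R : realType) (n : nat) (hn : (1 <= n)%N) :
  exists Psi : 'Cx[R]_n -> 'Cx[R]_n,
    [/\ symplectomorphism cigar_form standard_form Psi,
        Psi 0 = 0 &
        forall (k : nat) (S : set 'Cx[R]_n) (A : set (param R k n)),
          (k <= n)%N ->
          complex_submanifold S A ->
          submanifold_connected S A ->
          submanifold_complete A cigar_metric ->
          totally_geodesic A cigar_metric ->
          S 0 ->
          complex_linear_subspace (Psi @` S)].
Proof.
exists Psi; split; [exact: symplectomorphism_Psi|exact: Psi0|].
move=> k S A _ S_sub S_conn S_complete S_tg S0.
have [_ hS _] := S_sub; have [phi0 Aphi0 [x0 Ux0 phi0x0]] := hS 0 S0.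
exact: (Psi_totally_geodesic S_sub S_conn S_complete S_tg Aphi0 Ux0 phi0x0).
Qed.
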